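(* If $f$ is a primitive Z-reduced form, then $\sigma(f)$ is a primitive binary string, and $\sigma$ restricts to a bijection $$\sigma\colon {}_pZ\to {}_pB_1$$ from the set of primitive Z-reduced forms to the set of primitive binary strings containing at least one $1$. The induced map $\overline{\sigma}$ restricts to a bijection between the set of primitive classes of odd weight and the set of primitive binary necklaces of odd weight. It also restricts to a bijection between the set of primitive classes of even weight and the set of primitive alternating necklaces of nonzero weight.
   Context: A form $(A,B,C)$ means $Ax^2+Bxy+Cy^2$ with $A,B,C\in\mathbb{Z}$; its discriminant is $\Delta=B^2-4AC$. All forms are indefinite: $\Delta$ is positive and not a square. A form is primitive if $\gcd(A,B,C)=1$. It is Z-reduced if $A,B,C>0$ and $B>A+C$; $Z$ is the set of Z-reduced forms and ${}_pZ$ its subset of primitive forms. Two forms are equivalent if related by a substitution $f(x,y)\mapsto f(\alpha x+\beta y,\gamma x+\delta y)$ with $\left[\begin{smallmatrix}\alpha&\beta\\ \gamma&\delta\end{smallmatrix}\right]\in \mathrm{SL}_2(\mathbb{Z})$; a class is an equivalence class, and it is primitive if its forms are primitive. Every class of indefinite forms contains Z-reduced forms. Fundamental solution: for a positive nonsquare discriminant $\Delta$, the fundamental solution of $|t^2-\Delta u^2|=4$ is the solution $(t,u)$ in positive integers with $u$ minimal (for $\Delta=5$, where $(1,1)$ and $(3,1)$ both have $u=1$, it is $(1,1)$). Map $\beta$: for $f=(A,B,C)\in Z$ of discriminant $\Delta$ with fundamental solution $(t,u)$, set $z=\frac{t+Bu}{2}$ (an integer) and expand $\frac{z}{z-Au}$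 as a finite regular continued fraction with positive integer partial quotients $q_1,\dots,q_l$, choosing between the two possible expansions so that $l$ is even if $t^2-\Delta u^2=-4$ and odd otherwise; $\beta(f)=(q_1,\dots,q_l)$, and always $l\ge2$. Map $\sigma$: for a sequence of positive integers of length $l\ge2$ let $\mathrm{sb}((q_1,\dots,q_l))=0^{q_1-1}1\,0^{q_2-1}1\cdots1\,0^{q_l-1}$ (a binary string with $l-1$ ones). Set $\sigma(f)=\mathrm{sb}(\beta(f))\in B_1$, where $B_1$ is the set of binary strings with at least one $1$. A nonempty string of length $n$ is primitive if the cyclic group of order $n$, acting by cyclic rotation, acts freely on it (i.e. no nontrivial rotation fixes the string). A binary necklace is an equivalence class of finite binary strings under cyclic rotation; it is primitive if its strings are primitive. The weight of a binary string or necklace is its number of $1$s. The weight of a Z-reduced form $f$ is the weight of $\sigma(f)$, and the weight of a class is the weight of any Z-reduced form in it (all Z-reduced forms in a class give strings that are cyclic rotations of one another). An alternating string is a binary string of even weight whose $1$s are colored with two colors (green and blue) so that the $1$s alternate colors along the string. An alternating necklace is an equivalence class of alternating strings under cyclic rotation, where the $0$s, $1$s and the colors must all match. Its underlying necklace is the binary necklace obtained by forgetting colors; the alternating necklace is primitive if its underlying necklace is primitive, and its weight is that of the underlying necklace. The map $\overline{\sigma}$ on classes: if $\mathfrak{c}$ has odd weight, $\overline{\sigma}(\mathfrak{c})$ is the binary necklace of $\sigma(f)$ for any Z-reduced $f\in\mathfrak{c}$. If $\mathfrak{c}$ has even weight, $\overline{\sigma}(\mathfrak{c})$ is the alternating necklace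 of $\sigma(f)$, for any Z-reduced $f\in\mathfrak{c}$, with $1$s alternately colored so that the first $1$ of $\sigma(f)$ from the left is green. These are well defined. *)

(* Defs.v *)
From HB Require Import structures.
From mathcomp Require Import all_boot all_order all_algebra.
From mathcomp Require Import boolp classical_sets functions.

Set Implicit Arguments.
Unset Strict Implicit.
Unset Printing Implicit Defensive.

Import Order.TTheory GRing.Theory Num.Theory.

Local Open Scope classical_set_scope.
Local Open Scope ring_scope.

(* [common_value u0 F A] is "F a for any a in A": the value u such that A is
   nonempty and F is constantly u on A.  If there is no such u, it is u0. *)
Definition common_value (T : Type) (U : choiceType) (u0 : U)
    (F : T -> U) (A : set T) : U :=
  xget u0 [set u | F @` A = [set u]].

(** ** Binary quadratic forms *)

(* Form A B C is A x^2 + B x y + C y^2. *)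
Record bqf : Type := Form { coefA : int; coefB : int; coefC : int }.

Definition form_eval (f : bqf) (x y : int) : int :=
  coefA f * x ^+ 2 + coefB f * x * y + coefC f * y ^+ 2.

Definition disc (f : bqf) : int := coefB f ^+ 2 - 4 * coefA f * coefC f.

Definition indefinite (f : bqf) : Prop :=
  0 < disc f /\ forall k : int, disc f <> k ^+ 2.

Definition primitive_form (f : bqf) : Prop :=
  gcdz (coefA f) (gcdz (coefB f) (coefC f)) = 1.

(* Reducedness includes indefiniteness: (2, 7, 3) satisfies the inequalities
   but its discriminant 25 is a square. *)
Definition Z_reduced (f : bqf) : Prop :=
  indefinite f /\
  [/\ 0 < coefA f, 0 < coefB f, 0 < coefC f & coefA f + coefC f < coefB f].

Definition form_equiv (f g : bqf) : Prop :=
  exists a b c d : int, a * d - b * c = 1 /\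
    forall x y : int, form_eval g x y = form_eval f (a * x + b * y) (c * x + d * y).

Definition form_class (f : bqf) : set bqf := [set g | form_equiv f g].

Definition is_form_class (c : set bqf) : Prop :=
  exists2 f, indefinite f & c = form_class f.

Definition primitive_class (c : set bqf) : Prop :=
  is_form_class c /\ forall f, c f -> primitive_form f.

(** ** The map beta *)

Definition pell4 (D : int) (t u : nat) : Prop :=
  [/\ (0 < t)%N, (0 < u)%N & `|t%:Z ^+ 2 - D * u%:Z ^+ 2| = 4].

(* Only for D = 5 can two solutions have the same minimal u. *)
Definition is_fundamental_solution (D : int) (tu : nat * nat) : Prop :=
  [/\ pell4 D tu.1 tu.2,
      forall t u : nat, pell4 D t u -> (tu.2 <= u)%N
    & D = 5 -> tu = (1%N, 1%N)].

Definition fundamental_solution (D : int) : nat * nat :=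
  xget (0%N, 0%N) [set tu | is_fundamental_solution D tu].

(* Value of the continued fraction [q_1; q_2, ..., q_l]; as 0^-1 = 0 in rat,
   the value of the one-term continued fraction [q_1] is q_1. *)
Fixpoint cf_value (q : seq nat) : rat :=
  if q is a :: q' then a%:R + (cf_value q')^-1 else 0.

Definition is_cf_expansion (x : rat) (q : seq nat) : Prop :=
  [/\ q != [::], all (leq 1) q & cf_value q = x].

Definition beta (f : bqf) : seq nat :=
  let D := disc f in
  let t := (fundamental_solution D).1 in
  let u := (fundamental_solution D).2 in
  let z : rat := (t%:R + (coefB f)%:~R * u%:R) / 2 in
  xget [::] [set q | is_cf_expansion (z / (z - (coefA f)%:~R * u%:R)) q /\
                     ~~ odd (size q) = (t%:Z ^+ 2 - D * u%:Z ^+ 2 == - 4)].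

(** ** Binary strings and the map sigma *)

(* Binary strings are boolean sequences: true is the digit 1, false is 0. *)

Fixpoint sb (q : seq nat) : seq bool :=
  match q with
  | [::] => [::]
  | [:: a] => nseq a.-1 false
  | a :: q' => nseq a.-1 false ++ true :: sb q'
  end.

Definition sigma (f : bqf) : seq bool := sb (beta f).

Definition string_weight (s : seq bool) : nat := count_mem true s.

Definition primitive_string (s : seq bool) : Prop :=
  s != [::] /\ forall k : nat, (0 < k < size s)%N -> rot k s <> s.

(** ** Necklaces *)

Definition rotation_class (T : Type) (s : seq T) : set (seq T) :=
  [set t | exists k : nat, t = rot k s].

Definition is_necklace (N : set (seq bool)) : Prop :=
  exists s, N = rotation_class s.

Definition primitive_necklace (N : set (seq bool)) : Prop :=
  is_necklace N /\ forall s, N s -> primitive_string s.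

Definition necklace_weight (N : set (seq bool)) : nat :=
  common_value 0%N string_weight N.

(* In a colored string None is the digit 0, Some true is a green 1 and
   Some false is a blue 1. *)
Definition colored_string : Type := seq (option bool).

Definition uncolor (s : colored_string) : seq bool := map isSome s.

Definition alternating (s : colored_string) : Prop :=
  ~~ odd (string_weight (uncolor s)) /\
  sorted (fun a b : bool => a != b) (pmap id s).

Definition is_alternating_necklace (N : set colored_string) : Prop :=
  exists2 s, alternating s & N = rotation_class s.

Definition underlying_necklace (N : set colored_string) : set (seq bool) :=
  uncolor @` N.

Definition primitive_alternating_necklace (N : set colored_string) : Prop :=
  is_alternating_necklace N /\ primitive_necklace (underlying_necklace N).

Definition alternating_necklace_weight (N : set colored_string) : nat :=
  necklace_weight (underlying_necklace N).

(* Color the 1s of s alternately, the first one with color g. *)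
Fixpoint color_from (g : bool) (s : seq bool) : colored_string :=
  match s with
  | [::] => [::]
  | false :: s' => None :: color_from g s'
  | true :: s' => Some g :: color_from (~~ g) s'
  end.

Definition green_first (s : seq bool) : colored_string := color_from true s.

(** ** Weights of forms and classes; the map sigma_bar *)

Definition form_weight (f : bqf) : nat := string_weight (sigma f).

Definition class_weight (c : set bqf) : nat :=
  common_value 0%N form_weight (c `&` [set f | Z_reduced f]).

(* The left summand consists of sets of binary strings, the right one of sets
   of colored strings. *)
Definition sigma_bar (c : set bqf) : set (seq bool) + set colored_string :=
  let cZ := c `&` [set f | Z_reduced f] in
  if odd (class_weight c)
  then inl (common_value set0 (fun f => rotation_class (sigma f)) cZ)
  else inr (common_value set0
              (fun f => rotation_class (green_first (sigma f))) cZ).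

(* Main.v *)
From mathcomp Require Import all_boot all_order all_algebra zify ring.
From mathcomp Require Import boolp classical_sets functions.
Require Import Defs.

(** A binary string s is encoded by a matrix: the digit 0 is the matrix with rows
    (1, 1), (0, 1), the digit 1 is the matrix with rows (1, 1), (1, 0), and s is
    the product. These two matrices generate a free monoid (string_mx_inj), and
    by the Euclidean algorithm its elements other than 1 are the nonnegative
    integer matrices of determinant 1 or -1 whose first row dominates the second
    (nonneg_mx_is_string_mx). The determinant records the parity of the weight.

    Take the coordinates in which f becomes f(x, y - x). A solution (t, u) of
    |t^2 - D u^2| = 4 gives an automorph of a reduced form f whose matrix lies in
    this monoid (auto_mx_is_string_mx), and completing its string by a final
    digit 1 turns it into the continued fraction of z / (z - A u). Hence sigma f
    is the factorization of the fundamental automorph of f (sigmaP). Conversely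
    the matrix of a string with a digit 1 is an automorph of exactly one primitive
    reduced form (string_formP), and two such matrices commute exactly when they
    have the same form (auto_mx_comm_eq). Since z grows strictly when a string is
    extended, minimality of the fundamental automorph among those of its form
    says that no nontrivial rotation fixes its string: a rotation fixing sigma f
    produces a shorter string commuting with it, and a
    primitive string commuting with the string of its form must equal it. The
    existence of automorphs comes from the finiteness of the set of reduced forms
    of given discriminant: reading letters one by one moves along a cycle of
    reduced forms (next_form).

    For classes, substituting a matrix M of determinant 1 in a form conjugates
    its automorphs by M. When both forms are reduced, the signs of their values
    force M or its inverse to be, up to sign, the matrix of a string w
    (intertwiner_string_or_inverse); then w conjugates the strings of the two
    forms, so they are rotations of each other, and w has even weight, so that
    the rotation respects alternating colorings. Conversely a rotation past an
    even number of digits 1 substitutes a matrix of determinant 1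
    (sigma_rot_equiv). When the weight is odd one can always rotate past an even
    number of digits 1, possibly in the other direction, so plain necklaces
    classify; when it is even the coloring keeps track of the parity. Every class
    contains a reduced form (exists_reduced), which makes this cover all
    classes. *)

Set Implicit Arguments.
Unset Strict Implicit.
Unset Printing Implicit Defensive.

Import Order.TTheory GRing.Theory Num.Theory.

(** * Two by two integer matrices *)

Section StringMatrices.

Local Open Scope ring_scope.

Definition mx2 (p q r s : int) : 'M[int]_2 :=
  \matrix_(i, j) (if i == 0 then if j == 0 then p else q
                  else if j == 0 then r else s).

Lemma mx2_eta (M : 'M[int]_2) : M = mx2 (M 0 0) (M 0 1) (M 1 0) (M 1 1).
Proof.
apply/matrixP=> i j; rewrite mxE; case: i j => [[|[|//]] ?] [[|[|//]] ?] /=;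
  by congr (M _ _); apply: val_inj.
Qed.

Lemma mx2P (M : 'M[int]_2) : exists p q r s, M = mx2 p q r s.
Proof. by rewrite [M]mx2_eta; do 4!eexists. Qed.

Lemma mx2_inj p q r s p' q' r' s' :
  mx2 p q r s = mx2 p' q' r' s' -> [/\ p = p', q = q', r = r' & s = s'].
Proof.
move/matrixP=> e.
by move: (e 0 0) (e 0 1) (e 1 0) (e 1 1); rewrite !mxE /=.
Qed.

Lemma mul_mx2 p q r s p' q' r' s' :
  mx2 p q r s * mx2 p' q' r' s' =
  mx2 (p * p' + q * r') (p * q' + q * s') (r * p' + s * r') (r * q' + s * s').
Proof.
by rewrite [LHS]mx2_eta !mxE !big_ord_recl !big_ord0 !mxE /= !addr0.
Qed.

Lemma mx2_one : 1 = mx2 1 0 0 1.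
Proof. by rewrite [LHS]mx2_eta !mxE. Qed.

Lemma add_mx2 p q r s p' q' r' s' :
  mx2 p q r s + mx2 p' q' r' s' = mx2 (p + p') (q + q') (r + r') (s + s').
Proof. by rewrite [LHS]mx2_eta !mxE. Qed.

Lemma opp_mx2 p q r s : - mx2 p q r s = mx2 (- p) (- q) (- r) (- s).
Proof. by rewrite [LHS]mx2_eta !mxE. Qed.

Lemma det_mx2 p q r s : \det (mx2 p q r s) = p * s - q * r.
Proof.
rewrite (expand_det_row _ 0) !big_ord_recl big_ord0 /cofactor !det_mx11 !mxE /=.
by rewrite /bump /= expr0 expr1 mul1r addr0 mulN1r mulrN.
Qed.

(** * The matrix of a binary string *)

Definition letter_mx (b : bool) : 'M[int]_2 :=
  if b then mx2 1 1 1 0 else mx2 1 1 0 1.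

Definition string_mx (s : seq bool) : 'M[int]_2 := \prod_(b <- s) letter_mx b.

Lemma string_mx_cons b s : string_mx (b :: s) = letter_mx b * string_mx s.
Proof. by rewrite /string_mx big_cons. Qed.

Lemma string_mx_cat s t : string_mx (s ++ t) = string_mx s * string_mx t.
Proof. by rewrite /string_mx big_cat. Qed.

Lemma string_mx_rcons s b : string_mx (rcons s b) = string_mx s * letter_mx b.
Proof. by rewrite -cats1 string_mx_cat {2}/string_mx big_seq1. Qed.

Lemma det_string_mx s : \det (string_mx s) = (-1) ^+ string_weight s.
Proof.
elim: s => [|b s IHs]; first by rewrite /string_mx big_nil det1.
rewrite string_mx_cons det_mulmx IHs; case: b; rewrite det_mx2 /string_weight /=.
- by rewrite exprS; ring.
- by ring.
Qed.

Lemma det_string_mx_unit s : \det (string_mx s) = 1 \/ \det (string_mx s) = -1.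
Proof.
by rewrite det_string_mx -signr_odd; case: odd; [right|left].
Qed.

(** Domination of the second row by the first one survives multiplication on
    the left by either letter; among nonnegative matrices of determinant 1 or -1
    it turns out to characterize the matrices of nonempty strings. *)
Lemma string_mx_shape s : exists p q r t,
  [/\ string_mx s = mx2 p q r t, 1 <= p, 0 <= q, 0 <= r <= p &
      0 <= t /\ (s != [::] -> t <= q)].
Proof.
elim: s => [|b s [p [q [r [t [e p1 q0 r0 [t0 _]]]]]]].
  by exists 1, 0, 0, 1; rewrite /string_mx big_nil mx2_one.
rewrite string_mx_cons e; case: b; rewrite mul_mx2; do 4!eexists; split;
  by [reflexivity|lia|lia|lia|split=> [|_]; lia].
Qed.

(** If both matrices were equal, the matrices of s and t would be obtained from
    each other by exchanging rows, so their two rows would be equal. *)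
Lemma string_mx_first_letter b s t :
  string_mx (b :: s) = string_mx (~~ b :: t) -> False.
Proof.
wlog: b s t / b = false => [hw|->].
  by case: b => /= e; [apply: (hw false t s)|apply: (hw false s t)].
rewrite /= !string_mx_cons.
have [p [q [r [x [e p1 q0 r0 [x0 e1]]]]]] := string_mx_shape s.
have [p' [q' [r' [x' [e' p1' q0' r0' [x0' e1']]]]]] := string_mx_shape t.
have := det_string_mx_unit s; rewrite e e' det_mx2 !mul_mx2.
move=> d /mx2_inj [] /= a1 a2 a3 a4.
have [es|/e1 ?] := eqVneq s [::].
  move: e; rewrite es /string_mx big_nil mx2_one => /mx2_inj [*]; lia.
have [es|/e1' ?] := eqVneq t [::].
  move: e'; rewrite es /string_mx big_nil mx2_one => /mx2_inj [*]; lia.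
have ? : p = r by lia.
have ? : q = x by lia.
subst; lia.
Qed.

Lemma string_mx_nil_cons b s : string_mx [::] <> string_mx (b :: s).
Proof.
have [p [q [r [x [e p1 q0 r0 [x0 _]]]]]] := string_mx_shape s.
rewrite string_mx_cons e /string_mx big_nil mx2_one.
by case: b; rewrite mul_mx2 => /mx2_inj [*]; lia.
Qed.

Lemma letter_mx_unit b : letter_mx b \is a GRing.unit.
Proof. by rewrite unitmxE; case: b; rewrite det_mx2. Qed.

(** Freeness of the monoid generated by the two letters: identities between
    strings can be checked on matrices. *)
Lemma string_mx_inj : injective string_mx.
Proof.
elim=> [|b s IHs] [|c t] //.
- by move/string_mx_nil_cons.
- by move/esym/string_mx_nil_cons.
have [->|] := eqVneq b c.
  by rewrite !string_mx_cons => /(mulrI (letter_mx_unit c)) /IHs ->.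
by case: b c => [] [] // _ /string_mx_first_letter.
Qed.

(** A two by two nonnegative matrix of determinant 1 or -1 has comparable rows
    unless it is a permutation matrix; this is the step of the Euclidean
    algorithm that finds the first letter. *)
Lemma nonneg_mx_is_string_mx (p q r s : int) :
  0 <= p -> 0 <= q -> 0 <= r <= p -> 0 <= s <= q ->
  (p * s - q * r = 1 \/ p * s - q * r = -1) ->
  exists w, mx2 p q r s = string_mx w.
Proof.
have [n] := ubnP (absz (p + q + r + s)).
elim: n p q r s => // n IHn p q r s lt_n p0 q0 /andP[r0 rp] /andP[s0 sq] d.
have rs0 : 0 < r + s by nia.
have [[h1 h2]|[[h1 h2]|[[h1 h2]|[h1 h2]]]] :
  (r <= p - r /\ s <= q - s) \/ (p - r <= r /\ q - s <= s) \/
   (r < p - r /\ q - s < s) \/ (p - r < r /\ s < q - s) by lia.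
- have [||||||w ew] := IHn (p - r) (q - s) r s; try lia.
  exists (false :: w); rewrite string_mx_cons -ew mul_mx2.
  by congr mx2; ring.
- have [||||||w ew] := IHn r s (p - r) (q - s); try lia.
  exists (true :: w); rewrite string_mx_cons -ew mul_mx2.
  by congr mx2; ring.
- have [r_0 qs] : r = 0 /\ q = s by nia.
  have [p_1 s_1] : p = 1 /\ s = 1 by nia.
  by exists [:: false]; rewrite /string_mx big_seq1 /=; congr mx2; lia.
- have [s_0 pr] : s = 0 /\ p = r by nia.
  have [q_1 r_1] : q = 1 /\ r = 1 by nia.
  by exists [:: true]; rewrite /string_mx big_seq1 /=; congr mx2; lia.
Qed.

End StringMatrices.

(** * Strings with a digit 1, and continued fractions *)

Section ContinuedFractions.

Local Open Scope ring_scope.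

Lemma string_mx_nseq n : string_mx (nseq n false) = mx2 1 n%:Z 0 1.
Proof.
elim: n => [|n IHn]; first by rewrite /string_mx big_nil mx2_one.
by rewrite /= string_mx_cons IHn mul_mx2; congr mx2; lia.
Qed.

Lemma string_mx_no_true s :
  true \notin s -> string_mx s = mx2 1 (size s)%:Z 0 1.
Proof.
move=> /negP s0; rewrite -string_mx_nseq; congr string_mx.
by apply/all_pred1P/allP => -[] // /s0.
Qed.

Lemma string_mx_true s : true \in s -> exists p q r t,
  [/\ string_mx s = mx2 p q r t, 1 <= p, 1 <= q, 1 <= r <= p & 0 <= t <= q].
Proof.
move=> s1; have [p [q [r [t [e p1 q0 r0 [t0 tq]]]]]] := string_mx_shape s.
have {}tq : t <= q by apply: tq; case: s s1 {e}.
have := det_string_mx_unit s; rewrite e det_mx2 => d.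
exists p, q, r, t; split; rewrite ?t0 //; first by nia.
suff : 0 < r by lia.
elim: s s1 p q r t e {p1 q0 r0 t0 tq d} => // -[] s IHs s1 p q r t.
  have [p' [q' [r' [t' [e' p1 q0 r0 [t0 tq]]]]]] := string_mx_shape s.
  by rewrite string_mx_cons e' mul_mx2 => /mx2_inj [*]; lia.
have [p' [q' [r' [t' e']]]] := mx2P (string_mx s).
have := IHs s1 _ _ _ _ e'.
by rewrite string_mx_cons e' mul_mx2 => ? /mx2_inj [*]; lia.
Qed.

Lemma sb_cons a q : q != [::] ->
  sb (a :: q) = nseq a.-1 false ++ true :: sb q.
Proof. by case: q. Qed.

Lemma string_weight_sb q : string_weight (sb q) = (size q).-1.
Proof.
rewrite /string_weight; elim: q => // a [|b q] IHq.
  by rewrite /= count_nseq mul0n.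
by rewrite sb_cons // count_cat count_nseq mul0n add0n [LHS]/= IHq.
Qed.

Lemma sb_surj s : exists2 q, q != [::] /\ all (leq 1) q & sb q = s.
Proof.
elim: s => [|[] s [q [q0 q1] <-]]; first by exists [:: 1%N].
  by exists (1%N :: q); rewrite ?sb_cons.
case: q q0 q1 => // a q _ /= /andP[a1 q1].
exists (a.+1 :: q) => //=; case: a a1 => // a _ /=.
by case: q q1.
Qed.

(** Multiplying by the letter 1 on the right completes the string of q to the
    product of the matrices of its partial quotients, whose first column is the
    last convergent. *)
Lemma string_mx_sb q : q != [::] -> all (leq 1) q -> exists a b c d : int,
  [/\ string_mx (sb q) * letter_mx true = mx2 a b c d,
      cf_value q = a%:~R / c%:~R, 1 <= a, 1 <= c & 0 <= b <= a /\ 0 <= d <= c].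
Proof.
elim: q => // x [|y q] IHq _ /= /andP[x1 q1].
  exists x%:Z, 1, 1, 0; split; try lia; last by rewrite invr0 addr0 divr1.
  by rewrite string_mx_nseq mul_mx2; congr mx2; lia.
have /(_ isT) := IHq _ q1; set y' := y :: q.
move=> [a [b [c [d [e v a1 c1 [hb hd]]]]]].
exists (x%:Z * a + c), (x%:Z * b + d), a, b; split.
- rewrite string_mx_cat string_mx_cons -!mulrA e string_mx_nseq !mul_mx2.
  have ex : x%:Z = x.-1%:Z + 1 by lia.
  by congr mx2; rewrite ?ex; ring.
- move: v => /= ->; rewrite invf_div rmorphD rmorphM /= mulrDl mulfK //.
  by rewrite intr_eq0; lia.
- by nia.
- by [].
- by split; nia.
Qed.

Lemma det_string_mx_sb q : q != [::] ->
  \det (string_mx (sb q)) = if odd (size q) then 1 else -1.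
Proof.
move=> q0; rewrite det_string_mx string_weight_sb -signr_odd.
by case: q q0 => // a q _ /=; case: odd.
Qed.

End ContinuedFractions.

(** * Automorphs of a reduced form *)

Section Automorphs.

Local Open Scope ring_scope.

(** Substituted in f(x, y - x), this matrix multiplies the form by its
    determinant. Its trace is t = 2 z - B u, so that z is the integer
    (t + B u) / 2 entering the definition of beta. *)
Definition auto_mx (f : bqf) (z u : int) : 'M[int]_2 :=
  mx2 (z - coefC f * u) (coefC f * u)
      ((coefB f - coefA f - coefC f) * u) (z - (coefB f - coefC f) * u).

Lemma det_auto_mx f z u :
  \det (auto_mx f z u) = z ^+ 2 - coefB f * z * u + coefA f * coefC f * u ^+ 2.
Proof. by rewrite det_mx2; ring. Qed.

Lemma det_auto_mx4 f z u : 4 * \det (auto_mx f z u) =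
  (2 * z - coefB f * u) ^+ 2 - disc f * u ^+ 2.
Proof. by rewrite det_auto_mx /disc; ring. Qed.

(** Positive solutions of |t^2 - D u^2| = 4, in the variables z and u. *)
Definition auto_unit (f : bqf) (z u : int) : Prop :=
  [/\ 0 < 2 * z - coefB f * u, 0 < u &
      \det (auto_mx f z u) = 1 \/ \det (auto_mx f z u) = -1].

Lemma auto_unit_pell f z u : auto_unit f z u <->
  0 < u /\ exists2 t : nat, 2 * z = t%:Z + coefB f * u & pell4 (disc f) t (absz u).
Proof.
rewrite /auto_unit /pell4; split=> [[t0 u0 d]|[u0 [t e [t0 _ d]]]].
  split=> //; exists (absz (2 * z - coefB f * u)%R); first by lia.
  have := det_auto_mx4 f z u; rewrite !gtz0_abs // => e; split; lia.
have := det_auto_mx4 f z u; have e' : 2 * z - coefB f * u = t%:Z by lia.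
move: d; rewrite gtz0_abs // e' => d e4; split; lia.
Qed.

Definition reduced_ineqs (f : bqf) : Prop :=
  [/\ 0 < coefA f, 0 < coefB f, 0 < coefC f & coefA f + coefC f < coefB f].

(** The equation forces t and B u to have the same parity. *)
Lemma pell_half_sum f t u : pell4 (disc f) t u ->
  exists z : int, 2 * z = t%:Z + coefB f * u%:Z.
Proof.
case=> _ _; rewrite /disc => h.
have [z e] : exists z : int,
    t%:Z + coefB f * u%:Z = 2 * z \/ t%:Z + coefB f * u%:Z = 2 * z + 1.
  exists ((t%:Z + coefB f * u%:Z) %/ 2)%Z.
  by move: (_ + _) => x; lia.
exists z; case: e => [-> //|e]; exfalso.
have et : t%:Z = 2 * z + 1 - coefB f * u%:Z by lia.
have : t%:Z ^+ 2 - (coefB f ^+ 2 - 4 * coefA f * coefC f) * u%:Z ^+ 2 =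
  4 * (z ^+ 2 + z - z * coefB f * u%:Z + coefA f * coefC f * u%:Z ^+ 2) + 1
   - 2 * (coefB f * u%:Z) by rewrite et; ring.
by move=> e'; rewrite e' in h; lia.
Qed.

Lemma disc_ge5 f : reduced_ineqs f -> 5 <= disc f.
Proof.
case: f => A B C [/= A0 B0 C0 AC]; rewrite /disc /=.
have -> : B ^+ 2 - 4 * A * C =
  (A - C) ^+ 2 + (B - A - C) * (B + A + C) by ring.
have : 0 <= (A - C) ^+ 2 by exact: sqr_ge0.
by nia.
Qed.

Lemma sqr_le_bound (t x k : int) :
  0 < t -> 0 <= k -> t ^+ 2 = x ^+ 2 + k -> - t <= x <= t.
Proof. by move=> t0 k0 e; apply/andP; split; nia. Qed.

Lemma mulz_ge1 (x y : int) : 0 < x -> 0 < y -> 1 <= x * y.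
Proof. exact: mulr_gt0. Qed.

(** The entries of an automorph are controlled by comparing the square of its
    trace with those of (B-2C)u, (B-2A)u and Bu: each difference is 4 times a
    positive integer plus or minus 4, hence of constant sign. *)
Lemma auto_mx_is_string_mx f z u : reduced_ineqs f -> auto_unit f z u ->
  exists s, string_mx s = auto_mx f z u.
Proof.
case: f => A B C [/= A0 B0 C0 AC] [/= t0 u0].
rewrite det_auto_mx /= => d.
set D := z ^+ 2 - B * z * u + A * C * u ^+ 2 in d.
have u20 : 0 < u ^+ 2 by exact: exprn_gt0.
have ACu : 1 <= A * C * u ^+ 2 by rewrite mulz_ge1 ?mulr_gt0.
have BA : 1 <= A * (B - A - C) * u ^+ 2 by rewrite mulz_ge1 ?mulr_gt0 //; lia.
have BC : 1 <= C * (B - A - C) * u ^+ 2 by rewrite mulz_ge1 ?mulr_gt0 //; lia.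
have Bu : 0 < B * u by exact: mulr_gt0.
have h1 : - (B * u) <= 2 * z - B * u <= B * u.
  apply: (@sqr_le_bound _ _ (4 * (A * C * u ^+ 2 - D))) => //; first by lia.
  by rewrite /D; ring.
have h2 : - (2 * z - B * u) <= (B - 2 * C) * u <= 2 * z - B * u.
  apply: (@sqr_le_bound _ _ (4 * (C * (B - A - C) * u ^+ 2 + D))) => //.
    by lia.
  by rewrite /D; ring.
have h3 : - (2 * z - B * u) <= (B - 2 * A) * u <= 2 * z - B * u.
  apply: (@sqr_le_bound _ _ (4 * (A * (B - A - C) * u ^+ 2 + D))) => //.
    by lia.
  by rewrite /D; ring.
have Cu : 0 < C * u by exact: mulr_gt0.
have au : 0 < (B - A - C) * u by rewrite mulr_gt0 //; lia.
have dE : (z - C * u) * (z - (B - C) * u) - C * u * ((B - A - C) * u) = D.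
  by rewrite /D; ring.
have [|||||w e] := @nonneg_mx_is_string_mx (z - C * u) (C * u)
    ((B - A - C) * u) (z - (B - C) * u).
- by clear - h1 h2 h3; lia.
- by clear - Cu; lia.
- by clear - h2 h3 au; lia.
- by clear - h1 h2; lia.
- by rewrite dE.
- by exists w; rewrite -e.
Qed.

End Automorphs.

(** * The string of a form is the factorization of its fundamental automorph *)

Section SigmaSpec.

Local Open Scope ring_scope.

Lemma auto_mx_letter_true f z u : auto_mx f z u * letter_mx true =
  mx2 z (z - coefC f * u) (z - coefA f * u)
      ((coefB f - coefA f - coefC f) * u).
Proof. by rewrite mul_mx2; congr mx2; ring. Qed.

(** The quotient of the first column and the determinant determine the matrix
    of a continued fraction: the first column is coprime, and the second column
    is known up to multiples of the first one. *)
Lemma convergent_mx_unique (a b c d a' b' c' d' : int) :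
  0 < a -> 0 < c -> 0 <= b <= a -> 0 <= d <= c ->
  0 < a' -> 0 < c' -> 0 <= b' < a' -> 0 < d' <= c' ->
  a * c' = a' * c -> a * d - b * c = a' * d' - b' * c' ->
  (a * d - b * c = 1 \/ a * d - b * c = -1) ->
  mx2 a b c d = mx2 a' b' c' d'.
Proof.
move=> a0 c0 hb hd a0' c0' hb' hd' eac edet dpm.
have dvd_a (x y x' y' v w v' w' : int) : 0 < x -> 0 < x' ->
    x * y' = x' * y -> (x' * w' - v' * y' = 1 \/ x' * w' - v' * y' = -1) ->
    x' <= x.
  move=> x0 x0' exy dxy.
  have : x * (x' * w' - v' * y') = x' * (x * w' - v' * y).
    have -> : x * (x' * w' - v' * y') = x' * x * w' - v' * (x * y') by ring.
    by rewrite exy; ring.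
  have bound k : x = x' * k -> x' <= x.
    by move=> e; rewrite e ler_pMr // -gtz0_ge1 -(pmulr_rgt0 k x0') -e.
  case: dxy => -> e; first by apply: (bound (x * w' - v' * y)); rewrite -e mulr1.
  by apply: (bound (- (x * w' - v' * y))); rewrite mulrN -e mulrN1 opprK.
have ea : a = a'.
  have h1 := dvd_a a c a' c' b d b' d' a0 a0' eac.
  have h2 := dvd_a a' c' a c b' d' b d a0' a0 (esym eac) dpm.
  rewrite edet in dpm; have := h1 dpm; lia.
subst a'; have ec : c = c' by apply: (mulfI (lt0r_neq0 a0)); rewrite eac.
subst c'.
have e : a * (d - d') = (b - b') * c by lia.
have eb : (b - b') * (a * d - b * c) = a * ((b - b') * d - b * (d - d')).
  have -> : (b - b') * (a * d - b * c) = a * ((b - b') * d) - b * ((b - b') * c).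
    by ring.
  by rewrite -e; ring.
have [k ek] : exists k, b - b' = a * k.
  case: dpm => h; rewrite h in eb.
  - by exists ((b - b') * d - b * (d - d')); rewrite -eb mulr1.
  - by exists (- ((b - b') * d - b * (d - d'))); rewrite mulrN -eb mulrN1 opprK.
have ed : d - d' = c * k.
  by apply: (mulfI (lt0r_neq0 a0)); rewrite e ek; ring.
have k0 : k = 0 by nia.
by congr mx2; lia.
Qed.


Lemma string_mx_sigma f z : let tu := fundamental_solution (disc f) in
  reduced_ineqs f -> auto_unit f z tu.2%:Z -> 2 * z = tu.1%:Z + coefB f * tu.2%:Z ->
  string_mx (sigma f) = auto_mx f z tu.2%:Z.
Proof.
move=> tu red au ez; case: (red) => A0 B0 C0 AC; case: (au) => _ u0 dpm.
have [w ew] := auto_mx_is_string_mx red au.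
have [p [q [r [s [emx p1 q0 rp [s0 _]]]]]] := string_mx_shape w.
have Cu : 0 < coefC f * tu.2%:Z by exact: mulr_gt0.
have ru : 0 < (coefB f - coefA f - coefC f) * tu.2%:Z by rewrite mulr_gt0 //; lia.
rewrite emx in ew; have [ep eq er es] := mx2_inj ew.
have zq : z%:~R = (tu.1%:R + (coefB f)%:~R * tu.2%:R) / 2 :> rat.
  apply: (@mulIf _ (2 : rat)) => //; rewrite divfK //.
  by rewrite mulrC -[2]/(2%:~R) -intrM ez rmorphD rmorphM.
have zAq : z%:~R - (coefA f)%:~R * tu.2%:R = (z - coefA f * tu.2%:Z)%:~R :> rat.
  by rewrite rmorphB rmorphM.
have bE : beta f = xget [::] [set q | is_cf_expansion
    (z%:~R / (z - coefA f * tu.2%:Z)%:~R) q /\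
    ~~ odd (size q) = (\det (auto_mx f z tu.2%:Z) == -1)].
  rewrite /beta -/tu -zq zAq; congr (xget _ _); apply/seteqP.
  have e4 := det_auto_mx4 f z tu.2%:Z.
  have -> : (\det (auto_mx f z tu.2%:Z) == -1) =
            (tu.1%:Z ^+ 2 - disc f * tu.2%:Z ^+ 2 == - 4); last by split.
    have -> : tu.1%:Z = 2 * z - coefB f * tu.2%:Z by lia.
    by rewrite -e4; lia.
have ex_q : exists q, is_cf_expansion
    (z%:~R / (z - coefA f * tu.2%:Z)%:~R) q /\
    ~~ odd (size q) = (\det (auto_mx f z tu.2%:Z) == -1).
  have [q' [q'0 q'1] eq'] := sb_surj w.
  have [a [b [c [d [e v _ _ _]]]]] := string_mx_sb q'0 q'1.
  rewrite eq' emx ew auto_mx_letter_true in e.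
  have [ea _ ec _] := mx2_inj e; rewrite -ea -ec in v.
  exists q'; split; first by split.
  have := det_string_mx_sb q'0; rewrite eq' emx ew => ->.
  by case: odd.
rewrite /sigma bE.
have [q' eq' [[q'0 q'1 v] odd_q]|/(_ _) H] := xgetP; last by case: ex_q => q' /H.
have [a [b [c [d [e v' a1 c1 [hb hd]]]]]] := string_mx_sb q'0 q'1.
apply: (mulIr (letter_mx_unit true)); rewrite e auto_mx_letter_true.
have dE : \det (auto_mx f z tu.2%:Z) = \det (string_mx (sb q')).
  rewrite det_string_mx_sb //; move: odd_q.
  by case: dpm => ->; case: odd.
have dV M : \det (M * letter_mx true) = - \det M.
  by rewrite det_mulmx det_mx2; ring.
have := dV (string_mx (sb q')); have := dV (auto_mx f z tu.2%:Z).
rewrite e auto_mx_letter_true dE !det_mx2 => d1 d2.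
apply: convergent_mx_unique; try lia.
have c0 : c%:~R != 0 :> rat by rewrite intr_eq0; lia.
have z0 : (z - coefA f * tu.2%:Z)%:~R != 0 :> rat by rewrite intr_eq0; lia.
by move: v; rewrite v' => /eqP; rewrite eqr_div // -!intrM eqr_int => /eqP.
Qed.

End SigmaSpec.

(** * Fundamental solutions and minimal automorphs *)

Section MinimalAutomorphs.

Local Open Scope ring_scope.

Lemma fundamental_solutionP D : (exists t u, pell4 D t u) ->
  is_fundamental_solution D (fundamental_solution D).
Proof.
move=> ex_tu; suff ex : exists tu, is_fundamental_solution D tu.
  exact: (xgetPex (0%N, 0%N) ex).
have [->|D5] := eqVneq D 5.
  by exists (1%N, 1%N); split=> // t u [].
have ex_u : exists u, `[< exists t, pell4 D t u >].
  by case: ex_tu => t [u tu]; exists u; apply/asboolP; exists t.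
case: (ex_minnP ex_u) => u /asboolP[t tu] min_u; exists (t, u); split=> //=.
  by move=> t' u' tu'; apply: min_u; apply/asboolP; exists t'.
by move/eqP: D5.
Qed.

(** Two positive solutions t < t' with the same u have squares differing by 8,
    so t = 1, t' = 3 and D = 5: the case in which the convention on the
    fundamental solution is needed. *)
Lemma fundamental_solution_le D tu t u : 5 <= D ->
  is_fundamental_solution D tu -> pell4 D t u ->
  (tu.2 <= u)%N /\ (tu.1 <= t)%N.
Proof.
move=> D5 []; case: tu => [t0 u0] /= [t00 u00 e0] min D5E tu.
have le_u := min _ _ tu; split=> //; rewrite leqNgt; apply/negP => lt_t.
case: tu => t_0 u_0 e.
have lt_sq : t%:Z ^+ 2 < t0%:Z ^+ 2 by rewrite ltr_sqr ?nnegrE //; lia.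
have [eu|ltu] : u0 = u \/ (u0 < u)%N by lia.
  subst u0.
  have e8 : t0%:Z ^+ 2 = t%:Z ^+ 2 + 8.
    by move: (D * u%:Z ^+ 2) e0 e => m; lia.
  have [et0 et] : t0 = 3%N /\ t = 1%N.
    have t04 : (t0 <= 4)%N by nia.
    have t3 : (t <= 3)%N by lia.
    clear - t_0 t3 t04 e8; move: t0 t t04 t3 t_0 e8.
    by case=> [|[|[|[|[|?]]]]] [|[|[|[|?]]]] // _ _ _ /eqP; split.
  subst t0 t; have em : D * u%:Z ^+ 2 = 5 by lia.
  have h : 5 * u%:Z ^+ 2 <= D * u%:Z ^+ 2 by rewrite ler_wpM2r ?sqr_ge0.
  have u1 : u = 1%N by nia.
  by subst u; have /D5E [] : D = 5 by lia.
have h : 3 <= u%:Z ^+ 2 - u0%:Z ^+ 2 by nia.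
have := @ler_pM _ 5 D 3 _ isT isT D5 h; rewrite mulrBr.
by move: (D * u%:Z ^+ 2) (D * u0%:Z ^+ 2) e0 e => m m0; lia.
Qed.

(** For a given f, z increases with t and u, so the fundamental solution is the
    one with the least z; this form of minimality is compared below with the
    growth of the matrices of strings. *)
Lemma sigmaP f : let tu := fundamental_solution (disc f) in
  reduced_ineqs f -> (exists z u, auto_unit f z u) ->
  exists z u, [/\ auto_unit f z u, string_mx (sigma f) = auto_mx f z u,
    forall z' u', auto_unit f z' u' -> z <= z' &
    u = tu.2%:Z /\ 2 * z = tu.1%:Z + coefB f * u].
Proof.
move=> tu red [z1 [u1 /auto_unit_pell[_ [t1 _ tu1]]]].
have fund : is_fundamental_solution (disc f) (fundamental_solution (disc f)).
  by apply: fundamental_solutionP; exists t1, (absz u1).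
rewrite -/tu in fund.
have [pell _ _] := fund; have [t0 u0 _] := pell.
have [z ez] := pell_half_sum pell.
have au : auto_unit f z tu.2%:Z.
  by apply/auto_unit_pell; split=> //; exists tu.1.
exists z, tu.2%:Z; split=> //; first exact: string_mx_sigma.
move=> z' u' /auto_unit_pell[u'0 [t' ez' pell']].
have [le_u le_t] := fundamental_solution_le (disc_ge5 red) fund pell'.
have {}le_u : tu.2%:Z <= u' by lia.
have [_ B0 _ _] := red.
have : coefB f * tu.2%:Z <= coefB f * u' by rewrite ler_pM2l.
by lia.
Qed.

End MinimalAutomorphs.

(** * The primitive form attached to a string *)

Section StringForms.

Local Open Scope ring_scope.

Lemma gcdz3_scale w a b c : 0 < w ->
  gcdz (w * a) (gcdz (w * b) (w * c)) = w * gcdz a (gcdz b c).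
Proof. by move=> w0; rewrite -mulz_gcdr gtz0_abs // -mulz_gcdr gtz0_abs. Qed.

Lemma scaled_primitive_eq f g u v : primitive_form f -> primitive_form g ->
  0 < u -> 0 < v -> u * coefA f = v * coefA g -> u * coefB f = v * coefB g ->
  u * coefC f = v * coefC g -> u = v /\ f = g.
Proof.
rewrite /primitive_form => pf pg u0 v0 eA eB eC.
have euv : u = v.
  by rewrite -[u]mulr1 -pf -gcdz3_scale // eA eB eC gcdz3_scale // pg mulr1.
split=> //; subst v; case: f g eA eB eC {pf pg} => A B C [A' B' C'] /=.
by move=> /(mulfI (lt0r_neq0 u0)) -> /(mulfI (lt0r_neq0 u0)) ->
  /(mulfI (lt0r_neq0 u0)) ->.
Qed.

Lemma auto_mx_comm f z u z' u' :
  auto_mx f z u * auto_mx f z' u' = auto_mx f z' u' * auto_mx f z u.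
Proof. by rewrite !mul_mx2; congr mx2; ring. Qed.

(** Commuting matrices have proportional traceless parts, and the traceless part
    of an automorph determines its primitive form. *)
Lemma auto_mx_comm_eq f g z u z' u' : reduced_ineqs f -> reduced_ineqs g ->
  primitive_form f -> primitive_form g -> 0 < u -> 0 < u' ->
  auto_mx f z u * auto_mx g z' u' = auto_mx g z' u' * auto_mx f z u -> f = g.
Proof.
move=> [_ _ Cf _] [_ _ Cg _] pf pg u0 u0' /esym.
rewrite !mul_mx2 => /mx2_inj [e1 e2 _ _].
have uu0 : u * u' != 0 by rewrite mulf_neq0 ?lt0r_neq0.
have eB : coefC g * coefB f = coefC f * coefB g.
  apply: (mulfI uu0); apply/eqP; rewrite -subr_eq0.
  by move/esym/eqP: e2; rewrite -subr_eq0 => /eqP <-; apply/eqP; ring.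
have er : coefC g * (coefB f - coefA f - coefC f) =
          coefC f * (coefB g - coefA g - coefC g).
  apply: (mulfI uu0); apply/eqP; rewrite -subr_eq0.
  by move/eqP: e1; rewrite -subr_eq0 => /eqP <-; apply/eqP; ring.
have eA : coefC g * coefA f = coefC f * coefA g by lia.
by case: (scaled_primitive_eq pf pg Cg Cf eA eB (mulrC _ _)).
Qed.

(** No two positive squares differ by 4. *)
Lemma not_square_near_sqr (t k : int) (d : int) : 0 < t -> d = 1 \/ d = -1 ->
  0 < t ^+ 2 - 4 * d -> t ^+ 2 - 4 * d <> k ^+ 2.
Proof.
move=> t0 d1 pos e.
have : t ^+ 2 - 4 * d = (absz k)%:Z ^+ 2 by rewrite e; lia.
have : 0 < (absz k)%:Z by nia.
move: (absz k) => m m0 {pos k}e.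
have [h|[h|[h|[h|h]]]] : t = m%:Z + 1 \/ t >= m%:Z + 2 \/ m%:Z = t + 1 \/
  m%:Z >= t + 2 \/ m%:Z = t by lia.
- by rewrite h in e; case: d1 => ?; subst d; lia.
- by case: d1 => ?; subst d; nia.
- by rewrite h in e; case: d1 => ?; subst d; lia.
- by case: d1 => ?; subst d; nia.
- by rewrite h in e; case: d1 => ?; subst d; lia.
Qed.

Lemma indefinite_of_auto f z u : reduced_ineqs f -> auto_unit f z u -> indefinite f.
Proof.
move=> red [t0 u0 d1]; have D5 := disc_ge5 red; split; first by lia.
move=> k ek; have e4 := det_auto_mx4 f z u.
have ed : (2 * z - coefB f * u) ^+ 2 - 4 * \det (auto_mx f z u) = (k * u) ^+ 2.
  by rewrite e4 ek exprMn; ring.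
apply: (not_square_near_sqr t0 d1 _ ed).
by rewrite e4 opprB addrC subrK mulr_gt0 ?exprn_gt0 //; lia.
Qed.

(** Dividing the traceless part of the matrix by its content gives the form. *)
Lemma string_formP s : true \in s -> exists f z u,
  [/\ Z_reduced f, primitive_form f, auto_unit f z u & string_mx s = auto_mx f z u].
Proof.
move=> s1; have [p [q [r [t [e p1 q1 rp tq]]]]] := string_mx_true s1.
have := det_string_mx_unit s; rewrite e det_mx2 => d.
set A' := p - t + q - r; set B' := p - t + 2 * q.
have A'0 : 0 < A' by rewrite /A'; nia.
pose u := gcdz A' (gcdz B' q).
have u0 : 0 < u.
  by rewrite lt_neqAle eq_sym gcdz_eq0 negb_and lt0r_neq0.
have [[A eA] [B eB] [C eC]] :
    [/\ exists A, A' = A * u, exists B, B' = B * u & exists C, q = C * u].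
  split; apply/dvdzP; rewrite ?dvdz_gcdl //;
    apply: (dvdz_trans (dvdz_gcdr _ _)); rewrite ?dvdz_gcdl ?dvdz_gcdr //.
pose f := Form A B C.
have em : mx2 p q r t = auto_mx f (p + q) u.
  by rewrite /auto_mx /=; congr mx2; rewrite ?mulrBl -?eA -?eB -?eC /A' /B'; ring.
have C0 : 0 < C by rewrite -(pmulr_lgt0 _ u0) -eC; lia.
have red : reduced_ineqs f.
  split=> //=.
  - by rewrite -(pmulr_lgt0 _ u0) -eA.
  - by rewrite -(pmulr_lgt0 _ u0) -eB /B'; lia.
  - by rewrite -subr_gt0 -(pmulr_lgt0 _ u0) mulrBl mulrDl -eA -eB -eC /A' /B'; lia.
have au : auto_unit f (p + q) u.
  split=> //=; first by rewrite -eB /B'; lia.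
  by rewrite -em det_mx2.
exists f, (p + q), u; split=> //.
- by split=> //; exact: indefinite_of_auto au.
- rewrite /primitive_form /=; apply: (mulfI (lt0r_neq0 u0)).
  rewrite mulr1 -gcdz3_scale //.
  by rewrite ![u * _]mulrC -eA -eB -eC.
Qed.

End StringForms.

(** * Cycles of reduced forms and the existence of automorphs *)

Section Cycles.

Local Open Scope ring_scope.

Lemma primitive_formP f : primitive_form f <-> forall d,
  (d %| coefA f)%Z -> (d %| coefB f)%Z -> (d %| coefC f)%Z -> (d %| 1)%Z.
Proof.
rewrite /primitive_form; split=> [p d dA dB dC|].
  by rewrite -[1%Z]/(1 : int) -p !dvdz_gcd dA dB.
set g := gcdz _ _ => /(_ g) h.
have : (g %| 1)%Z.
  by apply: h; rewrite ?dvdz_gcdl //; apply: (dvdz_trans (dvdz_gcdr _ _));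
    rewrite ?dvdz_gcdl ?dvdz_gcdr.
have : 0 <= g by [].
by rewrite dvdz1 => g0 /eqP; lia.
Qed.

(** Traceless matrix of the form f(x, y - x): substituting a matrix of
    determinant 1 in that form conjugates this matrix. *)
Definition form_mx (f : bqf) : 'M[int]_2 :=
  mx2 (coefB f - 2 * coefC f) (2 * coefC f)
      (2 * (coefB f - coefA f - coefC f)) (2 * coefC f - coefB f).

Lemma det_form_mx f : \det (form_mx f) = - disc f.
Proof. by rewrite det_mx2 /disc; ring. Qed.

(** The next form of the cycle; the sign of f(2, -1) tells on which side of 2
    the positive root of f(x, y - x) = 0 lies, hence which letter comes next. *)
Definition next_form (f : bqf) : bqf :=
  let: Form A B C := f in
  if 0 < form_eval f 2 (-1) then Form (4 * A - 2 * B + C) (4 * A - B) A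
  else Form (2 * B - 4 * A - C) (3 * B - 4 * A - 2 * C) (B - A - C).

Lemma next_formP f : Z_reduced f -> exists b,
  Z_reduced (next_form f) /\
  form_mx f * letter_mx b = letter_mx b * form_mx (next_form f).
Proof.
case=> ind red.
have [b [red' e]] : exists b, reduced_ineqs (next_form f) /\
    form_mx f * letter_mx b = letter_mx b * form_mx (next_form f).
  case: f ind red => A B C [_ nsq] [/= A0 B0 C0 AC]; rewrite /form_eval /=.
  have v0 : A * 2 ^+ 2 + B * 2 * -1 + C * (-1) ^+ 2 != 0.
    apply/eqP => e; apply: (nsq (B - 4 * A)); rewrite /disc /=.
    have -> : C = 2 * B - 4 * A by lia.
    by ring.
  case: ifPn => h; [exists false|exists true].
    by split; [split=> /=; lia|rewrite /form_mx !mul_mx2 /=; congr mx2; ring].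
  by split; [split=> /=; lia|rewrite /form_mx !mul_mx2 /=; congr mx2; ring].
exists b; split=> //; split=> //.
suff -> : indefinite (next_form f) = indefinite f by [].
rewrite /indefinite; suff -> : disc (next_form f) = disc f by [].
apply: oppr_inj; rewrite -!det_form_mx.
have := congr1 determinant e; rewrite !det_mulmx mulrC => /mulfI ->//.
by case: b {e}; rewrite det_mx2.
Qed.

Lemma next_form_primitive f : primitive_form f -> primitive_form (next_form f).
Proof.
move=> /primitive_formP p; apply/primitive_formP => d; case: f p => A B C p.
rewrite /next_form; case: ifP => _ /= /dvdzP[x ex] /dvdzP[y ey] /dvdzP[w ew];
  apply: p => /=; apply/dvdzP.
- by exists w.
- by exists (4 * w - y); lia.
- by exists (x + 4 * w - 2 * y); lia.
- by exists (y - x - w); lia.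
- by exists (3 * y - 2 * x - 4 * w); lia.
- by exists (2 * y - x - 4 * w); lia.
Qed.

Lemma iter_next_formP f n : Z_reduced f -> exists w, size w = n /\
  Z_reduced (iter n next_form f) /\
  form_mx f * string_mx w = string_mx w * form_mx (iter n next_form f).
Proof.
move=> red; elim: n => [|n [w [sz [redn e]]]].
  by exists [::]; rewrite /string_mx big_nil mulr1 mul1r.
have [b [red' e']] := next_formP redn.
exists (rcons w b); rewrite size_rcons sz; split=> //; split=> //.
by rewrite string_mx_rcons mulrA e -!mulrA e'.
Qed.

Lemma disc_intertwined f g w :
  form_mx f * string_mx w = string_mx w * form_mx g -> disc f = disc g.
Proof.
move=> e; apply: oppr_inj; rewrite -!det_form_mx.
have := congr1 determinant e; rewrite !det_mulmx mulrC => /mulfI -> //.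
by case: (det_string_mx_unit w) => ->.
Qed.

Lemma reduced_coef_le f : reduced_ineqs f ->
  coefA f + coefB f + coefC f <= disc f.
Proof.
case: f => A B C [/= A0 B0 C0 AC]; rewrite /disc /=.
have -> : B ^+ 2 - 4 * A * C =
  (A - C) ^+ 2 + (B - A - C) * (A + B + C) by ring.
have : 0 <= (A - C) ^+ 2 by exact: sqr_ge0.
by nia.
Qed.

(** The inequality A + B + C <= disc f leaves finitely many reduced forms of a
    given discriminant. *)
Lemma next_form_periodic f : Z_reduced f ->
  exists i j, (i < j)%N /\ iter i next_form f = iter j next_form f.
Proof.
move=> red; pose D := absz (disc f).
pose box := ('I_D.+1 * 'I_D.+1 * 'I_D.+1)%type.
pose code (g : bqf) : box :=
  (inord (absz (coefA g)), inord (absz (coefB g)), inord (absz (coefC g))).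
pose in_box (g : bqf) := [/\ (absz (coefA g) < D.+1)%N,
  (absz (coefB g) < D.+1)%N & (absz (coefC g) < D.+1)%N].
have bound n : in_box (iter n next_form f) /\ reduced_ineqs (iter n next_form f).
  have [w [_ [[_ redg] /disc_intertwined e]]] := iter_next_formP n red.
  have := reduced_coef_le redg; rewrite -e; have [? ? ? ?] := redg.
  by rewrite /in_box /D; split=> //; split; lia.
have code_inj g h : in_box g /\ reduced_ineqs g -> in_box h /\ reduced_ineqs h ->
    code g = code h -> g = h.
  case: g h => A B C [A' B' C'].
  move=> [[/= hA hB hC] [/= ? ? ? ?]] [[/= hA' hB' hC'] [/= ? ? ? ?]].
  move=> e; have := congr1 (fun x : box => val x.1.1) e.
  have := congr1 (fun x : box => val x.1.2) e.
  have := congr1 (fun x : box => val x.2) e.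
  by rewrite /= !inordK // => *; congr Form; lia.
pose F (i : 'I_#|{: box}|.+1) := code (iter i next_form f).
have [inj_F|] := pselect (injective F).
  by have := leq_card F inj_F; rewrite card_ord ltnn.
move=> /existsNP[i /existsNP[j /not_implyP[eF nij]]].
have e : iter i next_form f = iter j next_form f.
  exact: code_inj (bound i) (bound j) eF.
have [lt|lt|/val_inj//] := ltngtP i j; first by exists i, j.
by exists j, i.
Qed.

Lemma form_mx_comm_auto f M : form_mx f * M = M * form_mx f ->
  auto_mx f 0 1 * M = M * auto_mx f 0 1.
Proof.
have [p [q [r [t ->]]]] := mx2P M.
rewrite /form_mx /auto_mx !mul_mx2 => /mx2_inj[*]; congr mx2; lia.
Qed.

(** A nonempty string whose matrix commutes with that of f has f as its form. *)
Lemma reduced_commuting_string f w : reduced_ineqs f -> primitive_form f ->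
  w != [::] -> form_mx f * string_mx w = string_mx w * form_mx f ->
  exists z u, auto_unit f z u.
Proof.
move=> red pf w0 e; have [w1|w1] := boolP (true \in w); last first.
  have [_ _ C0 _] := red; exfalso.
  have := e; rewrite string_mx_no_true // !mul_mx2 => /mx2_inj[h _ _ _].
  have : 0 < (size w)%:Z by rewrite ltz_nat lt0n size_eq0.
  by case: red => ? ? ? ?; nia.
have [g [z [u [[_ redg] pg au eg]]]] := string_formP w1.
exists z, u; have := form_mx_comm_auto e; rewrite eg => e'.
have [_ u0 _] := au.
by rewrite (auto_mx_comm_eq red redg pf pg ltr01 u0 e').
Qed.

(** Once around the cycle, the letters read compose to an automorph. *)
Lemma auto_unit_exists f : Z_reduced f -> primitive_form f ->
  exists z u, auto_unit f z u.
Proof.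
move=> red pf; have [i [j [lt_ij eij]]] := next_form_periodic red.
have [w [_ [redi ei]]] := iter_next_formP i red.
set g := iter i next_form f in eij redi ei.
have pg : primitive_form g.
  by rewrite /g; elim: (i) => //= n; exact: next_form_primitive.
have [w' [sz [_ e']]] := iter_next_formP (j - i) redi.
have eg : iter (j - i) next_form g = g.
  by rewrite [RHS]eij /g -iterD subnK // ltnW.
rewrite eg in e'; have w'0 : w' != [::] by rewrite -size_eq0 sz subn_eq0 -ltnNge.
have [z [u /auto_unit_pell[u0 [t _ pell]]]] :=
  reduced_commuting_string (proj2 redi) pg w'0 e'.
rewrite -(disc_intertwined ei) in pell; have [z' ez'] := pell_half_sum pell.
exists z', u; apply/auto_unit_pell; split=> //; exists t => //.
by move: ez'; rewrite gtz0_abs.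
Qed.

End Cycles.

(** * The bijection between primitive reduced forms and primitive strings *)

Section SigmaBijection.

Local Open Scope ring_scope.


Lemma string_mx_row_sum_lt s t p q r x p' q' r' x' : t != [::] ->
  string_mx s = mx2 p q r x -> string_mx (s ++ t) = mx2 p' q' r' x' ->
  p + q < p' + q'.
Proof.
move=> t0 es; rewrite string_mx_cat.
have [a [b [c [d [e a1 b0 c0 [d0 /(_ t0) db]]]]]] := string_mx_shape t.
have := det_string_mx_unit t; rewrite es e det_mx2 mul_mx2.
move=> dt /mx2_inj[e1 e2 _ _].
have [a' [b' [c' [d' [e' a1' b0' _ _]]]]] := string_mx_shape s.
rewrite e' in es; have [? ? _ _] := mx2_inj es; subst a' b'.
have ab : 2 <= a + b by nia.
have cd : 1 <= c + d by nia.
have -> : p' + q' = p * (a + b) + q * (c + d) by rewrite -e1 -e2; ring.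
by nia.
Qed.

Lemma auto_mx_row_sum f z u s t g z' u' : t != [::] ->
  string_mx s = auto_mx f z u -> string_mx (s ++ t) = auto_mx g z' u' -> z < z'.
Proof. by move=> t0 es /(string_mx_row_sum_lt t0 es); rewrite !subrK. Qed.

Lemma auto_mx_reduced_true f z u s : reduced_ineqs f -> 0 < u ->
  string_mx s = auto_mx f z u -> true \in s.
Proof.
move=> [A0 B0 C0 AC] u0 es; apply/contraT => /string_mx_no_true.
rewrite es => /mx2_inj[_ _ /eqP + _].
by rewrite mulf_eq0 => /orP[]/eqP; lia.
Qed.

Lemma sigma_autoP f : let tu := fundamental_solution (disc f) in
  Z_reduced f -> primitive_form f ->
  exists z u, [/\ auto_unit f z u, string_mx (sigma f) = auto_mx f z u,
    forall z' u', auto_unit f z' u' -> z <= z' &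
    u = tu.2%:Z /\ 2 * z = tu.1%:Z + coefB f * u].
Proof.
by move=> tu red pf; apply: sigmaP (proj2 red) (auto_unit_exists red pf).
Qed.

Lemma sigma_true f : Z_reduced f -> primitive_form f -> true \in sigma f.
Proof.
move=> red pf; have [z [u [[_ u0 _] es _ _]]] := sigma_autoP red pf.
exact: auto_mx_reduced_true (proj2 red) u0 es.
Qed.

(** A proper prefix x of the string that commutes with it would be the
    factorization of a smaller automorph of the same form. *)
Lemma sigma_primitive f : Z_reduced f -> primitive_form f ->
  primitive_string (sigma f).
Proof.
move=> red pf; have s1 := sigma_true red pf.
have [z [u [au es min _]]] := sigma_autoP red pf; have [_ u0 _] := au.
split=> [|k /andP[k0 lt_k] rot_s]; first by case: (sigma f) s1.
set s := sigma f in s1 es lt_k rot_s.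
set x := take k s; set y := drop k s.
have xy : x ++ y = s := cat_take_drop k s.
have yx : y ++ x = s := rot_s.
have y0 : y != [::] by rewrite -size_eq0 size_drop subn_eq0 -ltnNge.
have x0 : x != [::] by rewrite -size_eq0 size_takel ?(ltnW lt_k) // -lt0n.
have comm : auto_mx f z u * string_mx x = string_mx x * auto_mx f z u.
  by rewrite -es -{1}xy -yx !string_mx_cat mulrA.
have x1 : true \in x.
  apply/contraT => nx; have := comm.
  have sx : 0 < (size x)%:Z by rewrite ltz_nat lt0n size_eq0.
  rewrite string_mx_no_true //; move: (size x)%:Z sx => n n0.
  rewrite !mul_mx2 => /mx2_inj[h _ _ _].
  have /eqP : (coefB f - coefA f - coefC f) * u * n = 0 by lia.
  by case: (red) => _ [? ? ? ?]; rewrite !mulf_eq0 => /orP[/orP[]|]/eqP; lia.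
have [g [z' [u' [redg pg aug eg]]]] := string_formP x1.
rewrite eg in comm; have [_ u'0 _] := aug.
have fg := auto_mx_comm_eq (proj2 red) (proj2 redg) pf pg u0 u'0 comm.
subst g; have := min _ _ aug.
have := auto_mx_row_sum y0 eg; rewrite xy => /(_ _ _ _ es).
by lia.
Qed.

Lemma sigma_inj f g : Z_reduced f -> primitive_form f ->
  Z_reduced g -> primitive_form g -> sigma f = sigma g -> f = g.
Proof.
move=> redf pf redg pg e.
have [z [u [[_ u0 _] es _ _]]] := sigma_autoP redf pf.
have [z' [u' [[_ u0' _] es' _ _]]] := sigma_autoP redg pg.
apply: (@auto_mx_comm_eq f g z u z' u') => //;
  [exact: (proj2 redf)|exact: (proj2 redg)|].
by rewrite -es -es' e.
Qed.

(** The string s and the string of its form have matrices that are automorphs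
    of the same form, hence the two strings commute; the latter is the shorter
    one by minimality, so it is s when s is primitive. *)
Lemma sigma_surj s : primitive_string s -> true \in s ->
  exists f, [/\ Z_reduced f, primitive_form f & sigma f = s].
Proof.
move=> [s0 prim_s] s1; have [f [z [u [red pf au es]]]] := string_formP s1.
exists f; split=> //; have [z' [u' [au' es' min _]]] := sigma_autoP red pf.
have t1 := sigma_true red pf; set t := sigma f in es' t1 *.
have comm : s ++ t = t ++ s.
  by apply: string_mx_inj; rewrite !string_mx_cat es es' auto_mx_comm.
have [lt_st|le_ts] := ltnP (size s) (size t).
  have et : t = s ++ drop (size s) t.
    have := congr1 (take (size s)) comm; rewrite take_size_cat // take_cat lt_st.
    by move=> {1}->; rewrite cat_take_drop.
  have d0 : drop (size s) t != [::].
    by rewrite -size_eq0 size_drop subn_eq0 -ltnNge.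
  have := auto_mx_row_sum d0 es; rewrite -et => /(_ _ _ _ es').
  by have := min _ _ au; lia.
have [ets|nts] := eqVneq (size t) (size s).
  by move/eqP: comm; rewrite eqseq_cat // => /andP[/eqP].
have {nts} lt_ts : (size t < size s)%N by rewrite ltn_neqAle nts.
have e : s = t ++ drop (size t) s.
  have := congr1 (take (size t)) comm; rewrite take_cat lt_ts take_size_cat //.
  by move=> {1}<-; rewrite cat_take_drop.
case: (prim_s (size t)); first by rewrite lt_ts andbT lt0n size_eq0; case: (t) t1.
rewrite /rot; have := comm; rewrite [in RHS]e {1}e -catA => /eqP.
rewrite eqseq_cat // eqxx /= => /eqP ec.
have -> : take (size t) s = t by rewrite [X in take _ X]e take_size_cat.
by rewrite ec -e.
Qed.

End SigmaBijection.

(** * Equivalence of reduced forms *)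

Section Equivalence.

Local Open Scope ring_scope.

Lemma form_eval_inj f g : (forall x y, form_eval f x y = form_eval g x y) -> f = g.
Proof.
case: f g => A B C [A' B' C']; rewrite /form_eval /= => e.
by have := e 1 0; have := e 0 1; have := e 1 1 => *; congr Form; lia.
Qed.

Lemma form_mx_inj : injective form_mx.
Proof.
move=> [A B C] [A' B' C'] /mx2_inj[/= *].
by congr Form; lia.
Qed.

(** The substitution by the matrix with rows (a, b) and (c, d) becomes
    conjugation in the coordinates x, y - x. *)
Lemma form_equiv_substP f a b c d : a * d - b * c = 1 -> exists g,
  (forall x y, form_eval g x y = form_eval f (a * x + b * y) (c * x + d * y)) /\
  form_mx f * mx2 (a - b) b (a - b + c - d) (b + d) =
  mx2 (a - b) b (a - b + c - d) (b + d) * form_mx g.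
Proof.
move=> det1; case: f => A B C.
exists (Form (A * a ^+ 2 + B * a * c + C * c ^+ 2)
  (2 * A * a * b + B * (a * d + b * c) + 2 * C * c * d)
  (A * b ^+ 2 + B * b * d + C * d ^+ 2)).
split=> [x y|]; first by rewrite /form_eval /=; ring.
have scale p q r t : mx2 p q r t = mx2 ((a * d - b * c) * p)
    ((a * d - b * c) * q) ((a * d - b * c) * r) ((a * d - b * c) * t).
  by rewrite det1 !mul1r.
by rewrite /form_mx [LHS]mul_mx2 [LHS]scale mul_mx2 /=; congr mx2; ring.
Qed.

Lemma form_mx_conj f M : \det M = 1 ->
  exists2 g, form_equiv f g & form_mx f * M = M * form_mx g.
Proof.
have [p [q [r [t ->]]]] := mx2P M; rewrite det_mx2 => d1.
have det1 : (p + q) * (t - q) - q * (r - p + t - q) = 1 by rewrite -d1; ring.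
have [g [eg em]] := form_equiv_substP f det1.
exists g; first by exists (p + q), q, (r - p + t - q), (t - q).
have eM : mx2 (p + q - q) q (p + q - q + (r - p + t - q) - (t - q)) (q + (t - q)) =
  mx2 p q r t by congr mx2; ring.
by rewrite eM in em.
Qed.

Lemma form_equiv_mx f g : form_equiv f g <->
  exists2 M, \det M = 1 & form_mx f * M = M * form_mx g.
Proof.
split=> [[a [b [c [d [det1 eg]]]]]|[M det1 eM]].
  have [g' [eg' em]] := form_equiv_substP f det1.
  have <- : g' = g by apply: form_eval_inj => x y; rewrite eg' eg.
  by eexists; last exact: em; rewrite det_mx2 -det1; ring.
have [g' fg' em] := form_mx_conj f det1.
suff -> : g = g' by [].
apply: form_mx_inj; apply: (@mulrI _ M); first by rewrite unitmxE det1.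
by rewrite -eM -em.
Qed.

Lemma form_equiv_refl f : form_equiv f f.
Proof. by apply/form_equiv_mx; exists 1; rewrite ?det1 // mulr1 mul1r. Qed.

Lemma form_equiv_sym f g : form_equiv f g -> form_equiv g f.
Proof.
case/form_equiv_mx=> M det1 e.
have uM : M \is a GRing.unit by rewrite unitmxE det1.
apply/form_equiv_mx; exists M^-1; first by rewrite det_inv det1 invr1.
by apply: (mulrI uM); rewrite mulVKr // mulrA -e mulrK.
Qed.

Lemma form_equiv_trans f g h : form_equiv f g -> form_equiv g h -> form_equiv f h.
Proof.
move=> /form_equiv_mx[M d1 e] /form_equiv_mx[N d2 e2]; apply/form_equiv_mx.
by exists (M * N); rewrite ?det_mulmx ?d1 ?d2 ?mulr1 // mulrA e -!mulrA e2.
Qed.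

Lemma form_equiv_disc f g : form_equiv f g -> disc f = disc g.
Proof.
case/form_equiv_mx=> M d1 /(congr1 determinant); rewrite !det_mulmx d1 mulr1 mul1r.
by rewrite !det_form_mx => /oppr_inj.
Qed.

Lemma form_equiv_primitive f g :
  form_equiv f g -> primitive_form f -> primitive_form g.
Proof.
move=> /form_equiv_sym[a [b [c [d [_ ef]]]]] /primitive_formP pf.
apply/primitive_formP => n /dvdzP[A eA] /dvdzP[B eB] /dvdzP[C eC].
move: ef; rewrite /form_eval eA eB eC => ef.
apply: pf; apply/dvdzP.
- exists (A * a ^+ 2 + B * a * c + C * c ^+ 2).
  by have := ef 1 0; rewrite !mulr1 !mulr0 !addr0 => ef10; lia.
- exists (2 * A * a * b + B * (a * d + b * c) + 2 * C * c * d).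
  by have := ef 1 1; have := ef 1 0; have := ef 0 1; lia.
- exists (A * b ^+ 2 + B * b * d + C * d ^+ 2).
  by have := ef 0 1; lia.
Qed.

(** Moving in the first quadrant towards the positive x-axis keeps the form
    - a x^2 + b x y + c y^2 negative. *)
Lemma negative_sector (a b c p r q s : int) : 0 < a -> 0 < c -> 0 < p -> 0 < r ->
  0 < q -> 0 < s -> q * r = p * s + 1 ->
  - a * p ^+ 2 + b * p * r + c * r ^+ 2 < 0 ->
  - a * q ^+ 2 + b * q * s + c * s ^+ 2 < 0.
Proof.
move=> a0 c0 p0 r0 q0 s0 d neg.
have bra : b * r < a * p.
  have cr : 0 < c * r ^+ 2 by rewrite mulr_gt0 ?exprn_gt0.
  by rewrite -(ltr_pM2l p0); lia.
have e : r ^+ 2 * (- a * q ^+ 2 + b * q * s + c * s ^+ 2) =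
  s ^+ 2 * (- a * p ^+ 2 + b * p * r + c * r ^+ 2)
    - (q * r - p * s) * (a * (q * r) + s * (a * p - b * r)) by ring.
have r2 : 0 < r ^+ 2 by rewrite exprn_gt0.
have ps : p * s + 1 - p * s = 1 by ring.
rewrite -(pmulr_rlt0 _ r2) e d ps mul1r.
have h1 : s ^+ 2 * (- a * p ^+ 2 + b * p * r + c * r ^+ 2) < 0.
  by rewrite pmulr_rlt0 ?exprn_gt0.
have h2 : 0 < a * (p * s + 1) by rewrite mulr_gt0 //; nia.
have h3 : 0 < s * (a * p - b * r) by rewrite mulr_gt0 // subr_gt0.
by lia.
Qed.

(** This is f(x, y - x). The reduction inequalities say that it is negative at
    (1, 0) and positive at (0, 1) and (1, 1). *)
Definition shifted_eval (f : bqf) (x y : int) : int :=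
  - (coefB f - coefA f - coefC f) * x ^+ 2 + (coefB f - 2 * coefC f) * x * y
  + coefC f * y ^+ 2.

Lemma intertwiner_values f g p q r t : p * t - q * r = 1 ->
  form_mx f * mx2 p q r t = mx2 p q r t * form_mx g ->
  [/\ shifted_eval f p r = - (coefB g - coefA g - coefC g),
      shifted_eval f q t = coefC g & shifted_eval f (p + q) (r + t) = coefA g].
Proof.
move=> d1 e; have : mx2 t (- q) (- r) p * (form_mx f * mx2 p q r t) = form_mx g.
  rewrite e mulrA mul_mx2 /form_mx mul_mx2.
  have -> : t * p + - q * r = 1 by rewrite -d1; ring.
  have -> : - r * q + p * t = 1 by rewrite -d1; ring.
  by congr mx2; ring.
rewrite /form_mx !mul_mx2 /shifted_eval => /mx2_inj[e1 e2 e3 e4].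
have c1 : shifted_eval f p r = - (coefB g - coefA g - coefC g).
  by rewrite /shifted_eval; lia.
have c2 : shifted_eval f q t = coefC g by rewrite /shifted_eval; lia.
by rewrite /shifted_eval in c1 c2; split=> //; lia.
Qed.

(** The first column lies below the diagonal because its value is negative, and
    the second column cannot lie in the opposite quadrant, where negative_sector
    would make its value negative; the Euclidean algorithm then applies. *)
Lemma intertwiner_is_string f g p q r t : reduced_ineqs f -> reduced_ineqs g ->
  p * t - q * r = 1 -> form_mx f * mx2 p q r t = mx2 p q r t * form_mx g ->
  0 < p -> 0 <= r -> (r = 0 -> 0 <= q) -> exists w, mx2 p q r t = string_mx w.
Proof.
move=> [A0 B0 C0 AC] [A0' B0' C0' AC'] d e p0 r0 rq.
have [] := intertwiner_values d e; rewrite /shifted_eval.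
set a := coefB f - coefA f - coefC f; set b := coefB f - 2 * coefC f.
set c := coefC f => e1 e2 _.
have a0 : 0 < a by rewrite /a; lia.
have abc : a < b + c by rewrite /a /b /c; lia.
have [r_0|rn0] := eqVneq r 0.
  have [p1 t1] : p = 1 /\ t = 1 by rewrite r_0 in d; nia.
  exists (nseq (absz q) false); rewrite string_mx_nseq p1 t1 r_0.
  by congr mx2; have := rq r_0; lia.
have {r0 rq rn0} r0 : 0 < r by lia.
have pr : r < p.
  rewrite ltNge; apply/negP => le_pr.
  have e1' : - a * p ^+ 2 + b * p * r + c * r ^+ 2 = (b + c - a) * p ^+ 2
    + (b + 2 * c) * (p * (r - p)) + c * (r - p) ^+ 2 by ring.
  have h1 : 0 <= (b + c - a) * p ^+ 2 by rewrite mulr_ge0 ?sqr_ge0 //; lia.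
  have h2 : 0 <= (b + 2 * c) * (p * (r - p)).
    by rewrite mulr_ge0 ?mulr_ge0 //; lia.
  have h3 : 0 <= c * (r - p) ^+ 2 by rewrite mulr_ge0 ?sqr_ge0 //; lia.
  by lia.
have [t0|[t0|t0]] : 0 < t \/ t = 0 \/ t < 0 by lia.
- have q0 : 0 <= q by nia.
  have tq : t <= q by nia.
  by apply: nonneg_mx_is_string_mx; lia.
- have q1 : q ^+ 2 = 1 by rewrite t0 in d; nia.
  by move: e2; rewrite t0 q1; lia.
- have q0 : q < 0 by nia.
  have val : - a * (- q) ^+ 2 + b * (- q) * (- t) + c * (- t) ^+ 2 = coefC g.
    by rewrite -e2; ring.
  have := @negative_sector a b c p r (- q) (- t) a0 C0 p0 r0.
  by rewrite val e1 => h; exfalso; have : coefC g < 0; [apply: h|]; lia.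
Qed.

(** Reflecting y reverses the sign of the middle coefficient, so negative_sector
    also applies to a first column in the fourth quadrant. *)
Lemma intertwiner_sign f g p q r t : reduced_ineqs f -> reduced_ineqs g ->
  p * t - q * r = 1 -> form_mx f * mx2 p q r t = mx2 p q r t * form_mx g ->
  0 < p -> r < 0 -> 0 < t.
Proof.
move=> [A0 B0 C0 AC] [A0' B0' C0' AC'] d e p0 r0.
have [] := intertwiner_values d e; rewrite /shifted_eval.
set a := coefB f - coefA f - coefC f; set b := coefB f - 2 * coefC f.
set c := coefC f => e1 e2 _.
have a0 : 0 < a by rewrite /a; lia.
have [//|[t0|t0]] : 0 < t \/ t = 0 \/ t < 0 by lia.
- have q1 : q ^+ 2 = 1 by rewrite t0 in d; nia.
  by move: e2; rewrite t0 q1; lia.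
- have q0 : 0 < q by nia.
  have val1 : - a * p ^+ 2 + - b * p * - r + c * (- r) ^+ 2 =
    - (coefB g - coefA g - coefC g) by rewrite -e1; ring.
  have val2 : - a * q ^+ 2 + - b * q * - t + c * (- t) ^+ 2 = coefC g.
    by rewrite -e2; ring.
  have := @negative_sector a (- b) c p (- r) q (- t) a0 C0 p0.
  by rewrite val1 val2 => h; exfalso; have : coefC g < 0; [apply: h|]; lia.
Qed.

(** A matrix of determinant 1 carrying a reduced form to a reduced form is, up
    to sign, the matrix of a string or the inverse of one: read through the
    Euclidean algorithm, it moves forwards or backwards along the cycle. *)
Lemma intertwiner_string_or_inverse f g M :
  reduced_ineqs f -> reduced_ineqs g -> \det M = 1 ->
  form_mx f * M = M * form_mx g -> exists w,
  [\/ M = string_mx w, - M = string_mx w | exists2 N, M * N = 1 &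
     N = string_mx w \/ - N = string_mx w].
Proof.
move=> redf redg.
have pos p q r t : p * t - q * r = 1 ->
    form_mx f * mx2 p q r t = mx2 p q r t * form_mx g -> 0 < p ->
    exists w, mx2 p q r t = string_mx w \/ mx2 t (- q) (- r) p = string_mx w.
  move=> d e p0.
  have e' : form_mx g * mx2 t (- q) (- r) p = mx2 t (- q) (- r) p * form_mx f.
    have [iM Mi] : mx2 t (- q) (- r) p * mx2 p q r t = 1 /\
                   mx2 p q r t * mx2 t (- q) (- r) p = 1.
      by rewrite !mul_mx2 mx2_one; split; congr mx2; rewrite -?d; ring.
    rewrite -[LHS]mul1r -{1}iM -!mulrA; congr (_ * _).
    by rewrite mulrA -e -mulrA Mi mulr1.
  have d' : t * p - (- q) * (- r) = 1 by rewrite -d; ring.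
  have [r0|[r0|r0]] : 0 < r \/ r = 0 \/ r < 0 by lia.
  - have [||w] := intertwiner_is_string redf redg d e p0; try lia.
    by exists w; left.
  - have t1 : 0 < t by rewrite r0 in d; nia.
    have [q0|q0] : 0 <= q \/ q < 0 by lia.
      have [||w] := intertwiner_is_string redf redg d e p0; try lia.
      by exists w; left.
    have [||w] := intertwiner_is_string redg redf d' e' t1; try lia.
    by exists w; right.
  - have t1 := intertwiner_sign redf redg d e p0 r0.
    have [||w] := intertwiner_is_string redg redf d' e' t1; try lia.
    by exists w; right.
have [p [q [r [t ->]]]] := mx2P M; rewrite det_mx2 => d e.
have [p0|[p0|p0]] : 0 < p \/ p = 0 \/ p < 0 by lia.
- have [w [ew|ew]] := pos _ _ _ _ d e p0; exists w; first by constructor 1.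
  constructor 3; exists (mx2 t (- q) (- r) p); last by left.
  by rewrite mul_mx2 mx2_one; congr mx2; rewrite -?d; ring.
- exfalso; have [e1 _ _] := intertwiner_values d e.
  have : 0 <= coefC f * r ^+ 2.
    by case: redf => _ _ C0 _; rewrite mulr_ge0 ?sqr_ge0 // ltW.
  move: e1; rewrite /shifted_eval p0.
  by case: redg => _ _ _ ?; lia.
- have dn : (- p) * (- t) - (- q) * (- r) = 1 by rewrite -d; ring.
  have en : form_mx f * mx2 (- p) (- q) (- r) (- t) =
            mx2 (- p) (- q) (- r) (- t) * form_mx g.
    by rewrite -opp_mx2 mulrN mulNr e.
  have pn : 0 < - p by lia.
  have [w [ew|ew]] := pos _ _ _ _ dn en pn; exists w.
    by constructor 2; rewrite opp_mx2.
  constructor 3; exists (- mx2 (- t) (- - q) (- - r) (- p)); last by right; rewrite opprK.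
  by rewrite opp_mx2 mul_mx2 mx2_one; congr mx2; rewrite -?d; ring.
Qed.

(** Forms of equal discriminant have the same fundamental solution, so a
    substitution carrying f to g conjugates their fundamental automorphs. *)
Lemma intertwiner_sigma f g M : Z_reduced f -> primitive_form f ->
  Z_reduced g -> primitive_form g -> disc f = disc g ->
  form_mx f * M = M * form_mx g ->
  string_mx (sigma f) * M = M * string_mx (sigma g).
Proof.
move=> redf pf redg pg ed.
have [z [u [_ -> _ [eu ez]]]] := sigma_autoP redf pf.
have [z' [u' [_ -> _ [eu' ez']]]] := sigma_autoP redg pg.
rewrite -ed in eu' ez'; subst u u'.
set t := (fundamental_solution _).1%:Z in ez ez'.
set u := (fundamental_solution _).2%:Z in ez ez' *.
have [p [q [r [s ->]]]] := mx2P M.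
rewrite /form_mx /auto_mx !mul_mx2 => /mx2_inj[e1 e2 e3 e4].
have zE x : 2 * (z * x) = (t + coefB f * u) * x by rewrite mulrA ez.
have zE' x : 2 * (z' * x) = (t + coefB g * u) * x by rewrite mulrA ez'.
congr mx2.
- by have := congr1 ( *%R u) e1; have := zE p; have := zE' p; lia.
- by have := congr1 ( *%R u) e2; have := zE q; have := zE' q; lia.
- by have := congr1 ( *%R u) e3; have := zE r; have := zE' r; lia.
- by have := congr1 ( *%R u) e4; have := zE s; have := zE' s; lia.
Qed.

(** Equivalent reduced forms have conjugate strings, and the conjugating string
    has even weight because the substitution has determinant 1. *)
Lemma equiv_sigma_conj f g : Z_reduced f -> primitive_form f ->
  Z_reduced g -> primitive_form g -> form_equiv f g -> exists2 w,
  ~~ odd (string_weight w) &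
  sigma f ++ w = w ++ sigma g \/ sigma g ++ w = w ++ sigma f.
Proof.
move=> redf pf redg pg fg; have ed := form_equiv_disc fg.
have /form_equiv_mx[M d1 e] := fg.
have eS := intertwiner_sigma redf pf redg pg ed e.
have det_opp (N : 'M[int]_2) : \det (- N) = \det N.
  by have [p [q [r [t ->]]]] := mx2P N; rewrite opp_mx2 !det_mx2; ring.
have even w : \det (string_mx w) = 1 -> ~~ odd (string_weight w).
  by rewrite det_string_mx -signr_odd; case: odd.
have [w [ew|ew|[N MN ew]]] :=
  intertwiner_string_or_inverse (proj2 redf) (proj2 redg) d1 e; exists w.
- by apply: even; rewrite -ew.
- by left; apply: string_mx_inj; rewrite !string_mx_cat -ew.
- by apply: even; rewrite -ew det_opp.
- by left; apply: string_mx_inj; rewrite !string_mx_cat -ew mulrN mulNr eS.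
- have dN : \det N = 1.
    by have := congr1 determinant MN; rewrite det_mulmx d1 mul1r det1.
  by apply: even; case: ew => <-; rewrite ?det_opp.
- have NM : N * M = 1 by apply: mulmx1C.
  have eN : string_mx (sigma g) * N = N * string_mx (sigma f).
    rewrite -[LHS]mul1r -NM -!mulrA; congr (_ * _).
    by rewrite mulrA -eS -mulrA MN mulr1.
  right; apply: string_mx_inj; rewrite !string_mx_cat.
  by case: ew => <-; rewrite ?mulrN ?mulNr eN.
Qed.

(** Conversely, rotating the string past an even number of digits 1 substitutes
    a matrix of determinant 1 in the form. *)
Lemma sigma_rot_equiv f g x y : Z_reduced f -> primitive_form f ->
  Z_reduced g -> primitive_form g -> sigma f = x ++ y -> sigma g = y ++ x ->
  ~~ odd (string_weight x) -> form_equiv f g.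
Proof.
move=> redf pf redg pg ef eg evx.
have dx : \det (string_mx x) = 1 by rewrite det_string_mx -signr_odd (negPf evx).
have [h fh em] := form_mx_conj f dx; set M := string_mx x in dx em.
have [z [u [[_ u0 _] es _ _]]] := sigma_autoP redf pf.
have [z' [u' [[_ u0' _] es' _ _]]] := sigma_autoP redg pg.
have conj : auto_mx f z u * M = M * auto_mx g z' u'.
  by rewrite -es -es' ef eg !string_mx_cat mulrA.
have uM : M \is a GRing.unit by rewrite unitmxE dx.
pose t := 2 * z - coefB f * u.
have double : auto_mx f z u + auto_mx f z u =
    mx2 t 0 0 t + mx2 u 0 0 u * form_mx f.
  by rewrite mul_mx2 !add_mx2; congr mx2; rewrite /t; ring.
have scalarC v : mx2 v 0 0 v * M = M * mx2 v 0 0 v.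
  by have [p [q [r [s ->]]]] := mx2P M; rewrite !mul_mx2; congr mx2; ring.
have : M * (auto_mx g z' u' + auto_mx g z' u') =
       M * (mx2 t 0 0 t + mx2 u 0 0 u * form_mx h).
  rewrite mulrDr -conj -mulrDl double mulrDl mulrDr scalarC -mulrA em.
  by rewrite !mulrA scalarC.
move=> /(mulrI uM); rewrite mul_mx2 !add_mx2 => /mx2_inj[e1 e2 e3 e4].
have [_ <-] // : u = u' /\ h = g.
apply: scaled_primitive_eq => //; first exact: form_equiv_primitive fh pf.
all: lia.
Qed.

End Equivalence.

(** * Reduction *)

Section Reduction.

Local Open Scope ring_scope.

Lemma form_equiv_indefinite f g : form_equiv f g -> indefinite f -> indefinite g.
Proof. by move/form_equiv_disc; rewrite /indefinite => ->. Qed.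

Lemma indefinite_neq0 A B C : indefinite (Form A B C) -> A != 0 /\ C != 0.
Proof.
case=> _ nsq; split; apply/eqP => e; apply: (nsq B); rewrite /disc /= e; ring.
Qed.

(** Descent on |B|: if A C > 0 then B^2 > 4 A C, so |B| exceeds 2 |A| or 2 |C|
    and a translation of one variable decreases it. *)
Lemma exists_opposite_signs f : indefinite f ->
  exists2 g, form_equiv f g & coefA g * coefC g < 0.
Proof.
have [n] := ubnP (absz (coefB f)).
elim: n f => // n IHn f ltn ind.
have [|AC] := ltP (coefA f * coefC f) 0; first by exists f => //; exact: form_equiv_refl.
case: f ltn ind AC => A B C /= ltn ind AC; have [A0 C0] := indefinite_neq0 ind.
have step g : form_equiv (Form A B C) g -> (absz (coefB g) < absz B)%N ->
    exists2 h, form_equiv (Form A B C) h & coefA h * coefC h < 0.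
  move=> fg lt_g; have [|h gh hh] := IHn g _ (form_equiv_indefinite fg ind).
    by apply: leq_trans lt_g _.
  by exists h => //; exact: form_equiv_trans fg gh.
have stepA (k : int) : (absz (B + 2 * k * A)%R < absz B)%N ->
    exists2 h, form_equiv (Form A B C) h & coefA h * coefC h < 0.
  move=> ltB; apply: (step (Form A (B + 2 * k * A) (A * k ^+ 2 + B * k + C))) => //.
  by exists 1, k, 0, 1; split=> [|x y]; rewrite /form_eval /=; ring.
have stepC (k : int) : (absz (B + 2 * k * C)%R < absz B)%N ->
    exists2 h, form_equiv (Form A B C) h & coefA h * coefC h < 0.
  move=> ltB; apply: (step (Form (A + B * k + C * k ^+ 2) (B + 2 * k * C) C)) => //.
  by exists 1, 0, k, 1; split=> [|x y]; rewrite /form_eval /=; ring.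
have [D0 _] := ind; rewrite /disc /= in D0.
have [gtA|leA] := ltnP (2 * absz A) (absz B).
  have [?|?] := ltP 0 A; have [?|?] := ltP 0 B;
    [apply: (stepA (-1))|apply: (stepA 1)|apply: (stepA 1)|apply: (stepA (-1))];
    lia.
have [gtC|leC] := ltnP (2 * absz C) (absz B).
  have [?|?] := ltP 0 C; have [?|?] := ltP 0 B;
    [apply: (stepC (-1))|apply: (stepC 1)|apply: (stepC 1)|apply: (stepC (-1))];
    lia.
exfalso; have : (absz B * absz B <= 2 * absz A * (2 * absz C))%N by exact: leq_mul.
have : ((absz A * absz C)%N%:Z = A * C) by lia.
have : ((absz B * absz B)%N%:Z = B ^+ 2) by lia.
by lia.
Qed.

(** When f(1, 0) < 0 < f(0, 1), the least k with f(1, k) > 0 gives the reduced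
    basis (1, k), (0, 1), whose difference (1, k - 1) is still negative. *)
Lemma exists_reduced f : indefinite f -> exists2 g, form_equiv f g & Z_reduced g.
Proof.
move=> ind; have [g fg ACneg] := exists_opposite_signs ind.
have [h fh [A0 C0]] : exists2 h, form_equiv f h & coefA h < 0 /\ 0 < coefC h.
  move: ACneg; have [A0|A0|->] := ltrgt0P (coefA g); last by rewrite mul0r.
  - rewrite pmulr_rlt0 // => C0; exists (Form (coefC g) (- coefB g) (coefA g)) => //.
    apply: form_equiv_trans fg _; exists 0, (-1), 1, 0.
    by split=> [|x y]; rewrite /form_eval /=; ring.
  - by rewrite nmulr_rlt0 // => C0; exists g.
have [_ nsq] := form_equiv_indefinite fh ind.
case: h fh A0 C0 nsq => A B C fh /= A0 C0 nsq.
have ex_k : exists k : nat, 0 < A + B * k%:Z + C * k%:Z ^+ 2.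
  (* Here k (k - |B|) >= k > |A|, so C >= 1 suffices for positivity. *)
  exists (absz A + absz B + 1)%N; set k : int := _%:Z.
  have h1 : - k * k + k * (absz A)%:Z + k <= B * k by nia.
  have h2 : k ^+ 2 <= C * k ^+ 2 by nia.
  by nia.
case: (ex_minnP ex_k) => -[|k] kP min_k; first by lia.
have neg : A + B * k%:Z + C * k%:Z ^+ 2 < 0.
  rewrite ltNge le_eqVlt; apply/negP => /orP[/eqP e|/min_k]; last by lia.
  apply: (nsq (B + 2 * C * k%:Z)); rewrite /disc /=.
  have -> : A = - (B * k%:Z + C * k%:Z ^+ 2) by lia.
  by ring.
set g' := Form (A + B * k.+1%:Z + C * k.+1%:Z ^+ 2) (B + 2 * C * k.+1%:Z) C.
have fg' : form_equiv f g'.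
  apply: form_equiv_trans fh _; exists 1, 0, k.+1%:Z, 1.
  by split=> [|x y]; rewrite /form_eval /=; ring.
exists g' => //; split; first exact: form_equiv_indefinite fg' ind.
by split=> //=; lia.
Qed.

End Reduction.

(** * Rotations and alternating colorings *)

Section Rotations.

Local Open Scope classical_set_scope.

(** Copies of s can be removed from the front of w until w is a prefix of s. *)
Lemma comm_cat_rot (T : Type) (s t w : seq T) :
  s ++ w = w ++ t -> exists k, t = rot k s.
Proof.
have [n] := ubnP (size w); elim: n w => // n IHn w lt_n e.
have [lt_ws|le_sw] := ltnP (size w) (size s).
  exists (size w); have es := congr1 (take (size w)) e.
  rewrite take_cat lt_ws take_size_cat // in es.
  have ed := congr1 (drop (size w)) e.
  by rewrite drop_cat lt_ws drop_size_cat // in ed; rewrite /rot es ed.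
have ew := congr1 (take (size s)) e; rewrite take_size_cat // in ew.
rewrite take_cat ltn_neqAle le_sw andbT in ew.
have {}ew : s = take (size s) w.
  by move: ew; case: eqP => //= ->; rewrite subnn take0 cats0 take_size.
have ed := congr1 (drop (size s)) e; rewrite drop_size_cat // in ed.
have [s0|s_gt0] := posnP (size s).
  move/size0nil: s0 => s0; move: e; rewrite s0 /= => /(congr1 (drop (size w))).
  by rewrite drop_size drop_size_cat // => <-; exists 0.
have wE : w = s ++ drop (size s) w by rewrite {1}ew cat_take_drop.
apply: (IHn (drop (size s) w)).
  by rewrite size_drop; lia.
have -> : drop (size s) w ++ t = drop (size s) (w ++ t).
  by rewrite {2}wE -catA drop_size_cat.
by rewrite -wE -ed.
Qed.

Lemma rot_sym (T : Type) k (s : seq T) : exists j, s = rot j (rot k s).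
Proof. by exists (size (rot k s) - k); have := rotK k s; rewrite /rotr. Qed.

Lemma rotation_class_rot (T : Type) k (s : seq T) :
  rotation_class (rot k s) = rotation_class s.
Proof.
apply/seteqP; split=> t [j ->]; first by rewrite rot_rot_add; eexists.
have [i e] := rot_sym k s.
by exists (rot_add (rot k s) i j); rewrite -rot_rot_add -e.
Qed.

Lemma rotation_class_refl (T : Type) (s : seq T) : rotation_class s s.
Proof. by exists 0; rewrite rot0. Qed.

Lemma rotation_class_eqP (T : Type) (s t : seq T) :
  rotation_class s = rotation_class t -> exists k, t = rot k s.
Proof. by move=> e; have := rotation_class_refl t; rewrite -e. Qed.

Lemma string_weight_rot k s : string_weight (rot k s) = string_weight s.
Proof. by apply/permP; rewrite perm_rot. Qed.

Lemma primitive_string_rot k s : primitive_string s -> primitive_string (rot k s).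
Proof.
case=> s0 prim; split=> [|j]; first by rewrite -size_eq0 size_rot size_eq0.
by rewrite size_rot rot_rot => /prim ne /rot_inj.
Qed.

Lemma string_weight_cat s t :
  string_weight (s ++ t) = string_weight s + string_weight t.
Proof. exact: count_cat. Qed.

Lemma string_weight_gt0 s : (0 < string_weight s) = (true \in s).
Proof. by rewrite -has_pred1 has_count. Qed.

Lemma color_from_cat g s t :
  color_from g (s ++ t) = color_from g s ++ color_from (g (+) odd (string_weight s)) t.
Proof.
elim: s g => [|[] s IHs] g /=; first by rewrite addbF.
- by rewrite IHs addbN addNb.
- by rewrite IHs.
Qed.

Lemma uncolorK g s : uncolor (color_from g s) = s.
Proof. by elim: s g => [|[] s IHs] g //=; rewrite /uncolor /= [map _ _]IHs. Qed.

Lemma size_color_from g s : size (color_from g s) = size s.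
Proof. by elim: s g => [|[] s IHs] g //=; rewrite IHs. Qed.

Lemma rot_color_from k g s : rot k (color_from g s) =
  color_from (g (+) odd (string_weight (take k s))) (drop k s)
    ++ color_from g (take k s).
Proof.
have [le_ks|lt_sk] := leqP k (size s); last first.
  by rewrite rot_oversize ?drop_oversize ?take_oversize ?size_color_from // ltnW.
have [x [y [-> <-]]] : exists x y, s = x ++ y /\ size x = k.
  by exists (take k s), (drop k s); rewrite cat_take_drop size_takel.
rewrite take_size_cat // drop_size_cat // color_from_cat.
by rewrite -(size_color_from g x) rot_size_cat.
Qed.

Lemma color_from_inj_sign s g h : true \in s -> color_from g s = color_from h s ->
  g = h.
Proof.
by elim: s => // -[] s IHs /=; [move=> _ []|rewrite inE => /IHs h' [] /h'].
Qed.

Lemma uncolor_rot k s : uncolor (rot k s) = rot k (uncolor s).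
Proof. exact: map_rot. Qed.

Lemma color_from_alternates g s :
  path (fun a b : bool => a != b) (~~ g) (pmap id (color_from g s)).
Proof.
elim: s g => [|[] s IHs] g //=.
by case: g => //=; [apply: (IHs false)|apply: (IHs true)].
Qed.

Lemma alternatingP s : alternating s -> exists g, s = color_from g (uncolor s).
Proof.
case=> _ srt.
have [g alt] : exists g, path (fun a b : bool => a != b) (~~ g) (pmap id s).
  case: (pmap id s) srt => [|a l] /= h; first by exists true.
  by exists a; rewrite h; case: a {h}.
exists g; elim: s g alt {srt} => // -[a|] s IHs g /=.
  case/andP=> ga pth; have <- : a = g by case: a g ga {pth} => [] [].
  by rewrite -(IHs (~~ a)) // negbK.
by move=> /IHs {1}->.
Qed.

Lemma alternating_green_first s : ~~ odd (string_weight s) ->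
  alternating (green_first s).
Proof.
move=> ev; split; first by rewrite uncolorK.
by have := color_from_alternates true s; rewrite /green_first; case: pmap => //= a l /andP[].
Qed.

Lemma underlying_rotation_class s :
  underlying_necklace (rotation_class s) = rotation_class (uncolor s).
Proof.
apply/seteqP; split=> [_ [_ [k ->] <-]|_ [k ->]]; first by exists k; rewrite uncolor_rot.
by exists (rot k s); [exists k|rewrite uncolor_rot].
Qed.

Lemma common_valueE (T : Type) (U : choiceType) (u0 : U) (F : T -> U) (A : set T) a :
  A a -> (forall b, A b -> F b = F a) -> common_value u0 F A = F a.
Proof.
move=> Aa const; have e : F @` A = [set F a].
  by apply/seteqP; split=> [_ [b /const -> <-] //|_ ->]; exists a.
apply: xget_unique => [//|u /= eu].
by have : [set u] u by []; rewrite -eu e.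
Qed.

Lemma necklace_weight_rotation_class s :
  necklace_weight (rotation_class s) = string_weight s.
Proof.
apply: common_valueE; first exact: rotation_class_refl.
by move=> _ [k ->]; exact: string_weight_rot.
Qed.

Lemma primitive_necklaceP s : primitive_necklace (rotation_class s) <-> primitive_string s.
Proof.
split=> [[_]|prim]; first by apply; exact: rotation_class_refl.
by split=> [|_ [k ->]]; [exists s|exact: primitive_string_rot].
Qed.

End Rotations.

(** * Primitive classes *)

Section Classes.

Local Open Scope classical_set_scope.

Lemma form_class_eq f g : form_equiv f g -> form_class f = form_class g.
Proof.
move=> fg; apply/seteqP; split=> h; last exact: form_equiv_trans.
by apply: form_equiv_trans; exact: form_equiv_sym.
Qed.

Lemma primitive_classP c : primitive_class c <->
  exists f, [/\ Z_reduced f, primitive_form f & c = form_class f].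
Proof.
split=> [[[f ind ->] prim]|[f [redf pf ->]]].
  have [g fg redg] := exists_reduced ind.
  by exists g; split=> //; [exact: prim|exact: form_class_eq].
split; first by exists f => //; exact: (proj1 redf).
by move=> g /form_equiv_primitive; apply.
Qed.

Lemma reduced_mem_class f :
  Z_reduced f -> (form_class f `&` [set g | Z_reduced g]) f.
Proof. by move=> redf; split=> //; exact: form_equiv_refl. Qed.

Lemma sigma_class f g : Z_reduced f -> primitive_form f ->
  (form_class f `&` [set g | Z_reduced g]) g -> exists k, sigma g = rot k (sigma f).
Proof.
move=> redf pf [fg redg]; have pg := form_equiv_primitive fg pf.
have [w _ [e|e]] := equiv_sigma_conj redf pf redg pg fg; first exact: (comm_cat_rot e).
have [k ->] := comm_cat_rot e; exact: rot_sym.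
Qed.

Lemma class_weight_reduced f : Z_reduced f -> primitive_form f ->
  class_weight (form_class f) = string_weight (sigma f).
Proof.
move=> redf pf; apply: common_valueE; first exact: reduced_mem_class.
by move=> g /(sigma_class redf pf)[k]; rewrite /form_weight => ->; exact: string_weight_rot.
Qed.

Lemma sigma_bar_odd f : Z_reduced f -> primitive_form f ->
  odd (string_weight (sigma f)) ->
  sigma_bar (form_class f) = inl (rotation_class (sigma f)).
Proof.
move=> redf pf oddf; rewrite /sigma_bar class_weight_reduced // oddf; congr inl.
apply: (@common_valueE _ _ set0 (fun f => rotation_class (sigma f))).
  exact: reduced_mem_class.
by move=> g /(sigma_class redf pf)[k ->]; exact: rotation_class_rot.
Qed.

(** Conjugation by a string of even weight respects the coloring. *)
Lemma sigma_bar_even f : Z_reduced f -> primitive_form f ->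
  ~~ odd (string_weight (sigma f)) ->
  sigma_bar (form_class f) = inr (rotation_class (green_first (sigma f))).
Proof.
move=> redf pf evf; rewrite /sigma_bar class_weight_reduced // (negPf evf); congr inr.
apply: (@common_valueE _ _ set0 (fun f => rotation_class (green_first (sigma f)))).
  exact: reduced_mem_class.
move=> g cg; have [fg redg] := cg; have pg := form_equiv_primitive fg pf.
have evg : ~~ odd (string_weight (sigma g)).
  by have [k ->] := sigma_class redf pf cg; rewrite string_weight_rot.
have [w evw e] := equiv_sigma_conj redf pf redg pg fg.
have color s t : ~~ odd (string_weight s) ->
    green_first (s ++ t) = green_first s ++ green_first t.
  by move=> ev; rewrite /green_first color_from_cat (negPf ev).
case: e => /(congr1 green_first); rewrite !color // => /comm_cat_rot[k ->];
  by rewrite rotation_class_rot.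
Qed.

(** If the string of g is that of f rotated past x, one of x and its complement
    has even weight, since the total weight is odd. *)
Lemma odd_class_inj f g : Z_reduced f -> primitive_form f ->
  Z_reduced g -> primitive_form g -> odd (string_weight (sigma f)) ->
  rotation_class (sigma f) = rotation_class (sigma g) -> form_equiv f g.
Proof.
move=> redf pf redg pg oddf /rotation_class_eqP[k eg].
have ef : sigma f = take k (sigma f) ++ drop k (sigma f).
  by rewrite cat_take_drop.
have [evx|oddx] := boolP (~~ odd (string_weight (take k (sigma f)))).
  exact: sigma_rot_equiv redf pf redg pg ef eg evx.
apply: form_equiv_sym; apply: (sigma_rot_equiv redg pg redf pf eg ef).
by move: oddf; rewrite {1}ef string_weight_cat oddD; move/negbNE: oddx => ->.
Qed.

(** An odd shift between the two strings would exchange the two colors. *)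
Lemma even_class_inj f g : Z_reduced f -> primitive_form f ->
  Z_reduced g -> primitive_form g -> ~~ odd (string_weight (sigma f)) ->
  rotation_class (green_first (sigma f)) =
    rotation_class (green_first (sigma g)) ->
  form_equiv f g.
Proof.
move=> redf pf redg pg evf /rotation_class_eqP[k eg].
have := congr1 uncolor eg; rewrite uncolor_rot !uncolorK => eg'.
set x := take k (sigma f); set y := drop k (sigma f).
have ef : sigma f = x ++ y by rewrite cat_take_drop.
have evx : ~~ odd (string_weight x).
  apply/negP => oddx; move: evf.
  rewrite ef string_weight_cat oddD oddx /= => /negbNE oddy.
  have y1 : true \in y by rewrite -string_weight_gt0; case: string_weight oddy.
  move: eg; rewrite eg' /green_first rot_color_from -/x -/y oddx /rot -/x -/y.
  rewrite color_from_cat => /eqP; rewrite eqseq_cat ?size_color_from //.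
  by case/andP=> /eqP/(color_from_inj_sign y1).
exact: sigma_rot_equiv redf pf redg pg ef eg' evx.
Qed.

(** If the first digit 1 is blue, rotating just past it makes the next one the
    first one, and that one is green. *)
Lemma alternating_necklace_green_first s : alternating s -> true \in uncolor s ->
  exists2 k, rotation_class s = rotation_class (green_first (rot k (uncolor s)))
    & ~~ odd (string_weight (uncolor s)).
Proof.
move=> alt s1; have [ev _] := alt; have [[] es] := alternatingP alt.
  by exists 0 => //; rewrite rot0 {1}es.
set t := uncolor s in es s1 ev *.
exists (index true t).+1 => //.
have tE : take (index true t).+1 t = rcons (take (index true t) t) true.
  by rewrite (take_nth true) ?index_mem // nth_index.
have w1 : string_weight (take (index true t).+1 t) = 1.
  have : true \notin take (index true t) t.
    by rewrite in_take_leq ?index_size // ltnn.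
  rewrite -string_weight_gt0 -leqNgt leqn0 => /eqP w0.
  by rewrite tE -cats1 string_weight_cat w0.
rewrite es -(rotation_class_rot (index true t).+1) rot_color_from w1 /=.
congr rotation_class; rewrite /green_first /rot color_from_cat; congr (_ ++ _).
congr color_from.
have := ev; rewrite -{1}(cat_take_drop (index true t).+1 t) string_weight_cat w1 oddD.
by case: (odd (string_weight (drop _ _))).
Qed.

End Classes.

Local Open Scope classical_set_scope.

Theorem theorem2p6 :
  (forall f : bqf, Z_reduced f -> primitive_form f ->
     primitive_string (sigma f)) /\
  set_bij [set f | Z_reduced f /\ primitive_form f]
          [set s | primitive_string s /\ true \in s]
          sigma /\
  set_bij [set c | primitive_class c /\ odd (class_weight c)]
          (inl @` [set N | primitive_necklace N /\ odd (necklace_weight N)])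
          sigma_bar /\
  set_bij [set c | primitive_class c /\ ~~ odd (class_weight c)]
          (inr @` [set N | primitive_alternating_necklace N /\
                           alternating_necklace_weight N <> 0%N])
          sigma_bar.
Proof.
split; first exact: sigma_primitive.
split.
  split=> [f [redf pf]|f g|s [prim s1]].
  - by split; [exact: sigma_primitive|exact: sigma_true].
  - by rewrite !inE => -[redf pf] [redg pg]; exact: sigma_inj.
  - by have [f [redf pf <-]] := sigma_surj prim s1; exists f.
split; split.
- move=> c [/primitive_classP[f [redf pf ->]]].
  rewrite class_weight_reduced // => oddf; rewrite sigma_bar_odd //.
  exists (rotation_class (sigma f)) => //; split.
    by apply/primitive_necklaceP; exact: sigma_primitive.
  by rewrite necklace_weight_rotation_class.
- move=> c d; rewrite !inE => -[/primitive_classP[f [redf pf ->]]] +.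
  move=> + [/primitive_classP[g [redg pg ->]]].
  rewrite !class_weight_reduced // => oddf oddg; rewrite !sigma_bar_odd // => -[e].
  by apply: form_class_eq; exact: odd_class_inj e.
- move=> _ [N [primN] + <-]; have [[s eN] _] := primN.
  rewrite eN necklace_weight_rotation_class in primN * => odds.
  move/primitive_necklaceP: primN => prim.
  have s1 : true \in s by rewrite -string_weight_gt0; case: string_weight odds.
  have [f [redf pf es]] := sigma_surj prim s1; subst s.
  exists (form_class f); last by rewrite sigma_bar_odd.
  by split; [apply/primitive_classP; exists f|rewrite class_weight_reduced].
- move=> c [/primitive_classP[f [redf pf ->]]].
  rewrite class_weight_reduced // => evf; rewrite sigma_bar_even //.
  exists (rotation_class (green_first (sigma f))) => //.
  rewrite /alternating_necklace_weight /= /primitive_alternating_necklace.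
  rewrite underlying_rotation_class uncolorK necklace_weight_rotation_class.
  split; last by apply/eqP; rewrite -lt0n string_weight_gt0 sigma_true.
  split; last by apply/primitive_necklaceP; exact: sigma_primitive.
  by exists (green_first (sigma f)) => //; exact: alternating_green_first.
- move=> c d; rewrite !inE => -[/primitive_classP[f [redf pf ->]]] +.
  move=> + [/primitive_classP[g [redg pg ->]]].
  rewrite !class_weight_reduced // => evf evg; rewrite !sigma_bar_even // => -[e].
  by apply: form_class_eq; exact: even_class_inj e.
- move=> _ [N [[[t alt ->]]] + + <-].
  rewrite /alternating_necklace_weight underlying_rotation_class.
  rewrite necklace_weight_rotation_class => /primitive_necklaceP prim /eqP.
  rewrite -lt0n string_weight_gt0 => t1.
  have [k -> ev] := alternating_necklace_green_first alt t1.
  have primk := primitive_string_rot k prim.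
  have t1k : true \in rot k (uncolor t) by rewrite mem_rot.
  have [f [redf pf es]] := sigma_surj primk t1k; rewrite -es.
  have evf : ~~ odd (string_weight (sigma f)) by rewrite es string_weight_rot.
  exists (form_class f); last by rewrite sigma_bar_even.
  by split; [apply/primitive_classP; exists f|rewrite class_weight_reduced].
Qed.
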